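(* Let $n\ge 1$ be an integer and let $\mathbb{H}^n$ be the $n$-dimensional Heisenberg group with its left invariant sub-Riemannian metric and the Lebesgue measure. For every $r>0$, the coarse Ricci curvature $\kappa$ associated with the $r$-step random walk on $\mathbb{H}^n$ satisfies $$\inf_{x,y\in\mathbb{H}^n,\ x\neq y}\kappa(x,y)\ \geq\ 1-2(2n+3).$$
   Context: The $n$-dimensional Heisenberg group $\mathbb{H}^n$ is $\mathbb{R}^{2n+1}$ with coordinates $(x_1,\dots,x_n,y_1,\dots,y_n,t)$ and group law $(x,y,t)\cdot(x',y',t')=(x+x',\,y+y',\,t+t'+\tfrac12\sum_i(x_iy'_i-y_ix'_i))$. The left invariant vector fields $X_i=\partial_{x_i}-\tfrac{y_i}{2}\partial_t$ and $Y_i=\partial_{y_i}+\tfrac{x_i}{2}\partial_t$ ($1\le i\le n$) span the horizontal distribution and are declared orthonormal. The left invariant sub-Riemannian (Carnot-Carathéodory) distance $d(p,q)$ is the infimum of $\int_0^1\big(\sum_i a_i(s)^2+b_i(s)^2\big)^{1/2}ds$ over absolutely continuous curves $\gamma:[0,1]\to\mathbb{R}^{2n+1}$ from $p$ to $q$ with $\dot\gamma(s)=\sum_i a_i(s)X_i(\gamma(s))+b_i(s)Y_i(\gamma(s))$ for a.e. $s$. The reference measure $\nu$ is the Lebesgue measure on $\mathbb{R}^{2n+1}$ (a Haar measure). The $r$-step random walk is the family $m^r_x=\frac{\chi_{B_r(x)}}{\nu(B_r(x))}\nu$, where $B_r(x)$ is the open $d$-ball of radius $r$ centered at $x$ and $\chi_{B_r(x)}$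 is its characteristic function. The associated coarse Ricci curvature is $\kappa(x,y)=1-\frac{W_1(m^r_x,m^r_y)}{d(x,y)}$ for $x\ne y$, where $W_1(\mu,\mu')=\inf_{\xi}\int d(x,y)\,d\xi(x,y)$ over all couplings $\xi$ of $\mu$ and $\mu'$. *)

(* Defs.v *)
From HB Require Import structures.
From mathcomp Require Import all_boot all_order all_algebra.
From mathcomp Require Import all_classical all_reals all_analysis.
From mathcomp Require Import ring.

Set Implicit Arguments.
Unset Strict Implicit.
Unset Printing Implicit Defensive.

Import Order.TTheory GRing.Theory Num.Theory.
Import numFieldNormedType.Exports.

Local Open Scope classical_set_scope.
Local Open Scope ring_scope.

Definition rV_display : measure_display.
Proof. exact: default_measure_display. Qed.

Section measurable_rV.
Context {R : realType} (n : nat).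

Let coord (i : 'I_n) (v : 'rV[R]_n) : measurableTypeR R := v ord0 i.

Let rV_set0 : g_sigma_preimage coord set0.
Proof. exact: sigma_algebra0. Qed.

Let rV_setC A : g_sigma_preimage coord A -> g_sigma_preimage coord (~` A).
Proof. exact: sigma_algebraC. Qed.

Let rV_bigcup (F : (set 'rV[R]_n)^nat) : (forall i, g_sigma_preimage coord (F i)) ->
  g_sigma_preimage coord (\bigcup_i F i).
Proof. exact: sigma_algebra_bigcup. Qed.

(* The sigma-algebra generated by the coordinates, that is, the Borel one. *)
HB.instance Definition _ := @isMeasurable.Build rV_display
  'rV[R]_n (g_sigma_preimage coord) rV_set0 rV_setC rV_bigcup.

Lemma measurable_coord (i : 'I_n) :
  measurable_fun setT (coord i).
Proof.
move=> _ Y mY; rewrite setTI; apply: sub_sigma_algebra => /=.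
rewrite -bigcup_seq/=; exists i => /=; first by rewrite mem_index_enum.
by exists Y => //; rewrite setTI.
Qed.

Lemma measurable_fun_rVP d (T : measurableType d) (f : T -> 'rV[R]_n) :
  measurable_fun setT f <-> forall i, measurable_fun setT (coord i \o f).
Proof.
split=> [mf i|mf]; first exact: measurableT_comp (measurable_coord i) mf.
move=> _ A mA; rewrite setTI.
suff : g_sigma_preimage coord `<=` [set B | measurable (f @^-1` B)] by exact.
apply: smallest_sub.
  split => /=; first by rewrite preimage_set0.
    by move=> B mB; rewrite setTD preimage_setC; exact: measurableC.
  by move=> F mF; rewrite preimage_bigcup; exact: bigcup_measurable.
rewrite -bigcup_seq => B [i _] [C mC]; rewrite setTI => <- /=.
by have := mf i measurableT C mC; rewrite setTI.
Qed.

End measurable_rV.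

Definition rV_cons {R : realType} {n : nat}
    (z : measurableTypeR R * 'rV[R]_n) : 'rV[R]_n.+1 :=
  row_mx (const_mx z.1 : 'rV[R]_1) z.2.

Lemma measurable_rV_cons {R : realType} {n : nat} :
  measurable_fun setT (@rV_cons R n).
Proof.
apply/measurable_fun_rVP => i.
case: (@split_ordP 1 n i) => j ->{i}.
  rewrite (_ : _ \o _ = fst); first exact: measurable_fst.
  by apply/funext => z; rewrite /= /rV_cons (row_mxEl _ _ ord0 j) mxE.
rewrite (_ : _ \o _ =
    (fun v : 'rV[R]_n => v ord0 j : measurableTypeR R) \o snd).
  by apply: measurableT_comp => //; exact: measurable_coord.
by apply/funext => z; exact: (row_mxEr (const_mx z.1 : 'rV[R]_1) z.2).
Qed.

Section cons_measure.
Context {R : realType} (m : nat).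
Variable mu : {sigma_finite_measure set 'rV[R]_m -> \bar R}.

Let prod_mu :
    {measure set (measurableTypeR R * 'rV[R]_m) -> \bar R} :=
  (lebesgue_measure \x mu)%E.

Definition cons_measure : set 'rV[R]_m.+1 -> \bar R :=
  pushforward (lebesgue_measure \x mu)%E rV_cons.

HB.instance Definition _ := Measure.copy cons_measure
  (measure_function_pushforward__canonical__measure_function_Measure
    prod_mu measurable_rV_cons).

Let cons_measure_sigma_finite : sigma_finite setT cons_measure.
Proof.
have /sigma_finiteP[F [TF ndF Foo]] := sigma_finiteT (@lebesgue_measure R).
have /sigma_finiteP[G [TG ndG Goo]] := sigma_finiteT mu.
pose uncons (v : 'rV[R]_m.+1) : measurableTypeR R * 'rV[R]_m :=
  (v ord0 ord0, \row_j v ord0 (lift ord0 j)).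
have uncons_mf : measurable_fun setT uncons.
  apply/measurable_fun_pairP; split; first exact: measurable_coord.
  apply/measurable_fun_rVP => i; rewrite (_ : _ \o _ =
    fun v : 'rV[R]_m.+1 => v ord0 (lift ord0 i) : measurableTypeR R).
    exact: measurable_coord.
  by apply/funext => v /=; rewrite mxE.
have unconsK z : uncons (rV_cons z) = z.
  case: z => t v; rewrite /uncons /rV_cons /=; congr pair.
    have -> : ord0 = @lshift 1 m ord0 by exact: val_inj.
    by rewrite (row_mxEl (const_mx t : 'rV[R]_1) v) mxE.
  apply/rowP => j; rewrite mxE.
  have -> : lift ord0 j = @rshift 1 m j by exact: val_inj.
  exact: (row_mxEr (const_mx t : 'rV[R]_1) v).
exists (fun k => uncons @^-1` (F k `*` G k)).
  apply/esym; rewrite -subTset => v _.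
  have [j _ Fj] : (\bigcup_k F k) (uncons v).1 by rewrite -TF.
  have [k _ Gk] : (\bigcup_k G k) (uncons v).2 by rewrite -TG.
  exists (maxn j k) => //; split.
  - by move: Fj; exact/subsetPset/ndF/leq_maxl.
  - by move: Gk; exact/subsetPset/ndG/leq_maxr.
move=> k; have [mF Fk] := Foo k; have [mG Gk] := Goo k; split.
  by rewrite -[X in measurable X]setTI; apply: uncons_mf => //; exact: measurableX.
rewrite /cons_measure /pushforward (_ : _ @^-1` _ = F k `*` G k).
  by rewrite product_measure1E// lte_mul_pinfty// ge0_fin_numE.
by apply/funext => z; rewrite -[in RHS](unconsK z).
Qed.

HB.instance Definition _ := Measure_isSigmaFinite.Build _ _ _
  cons_measure cons_measure_sigma_finite.

End cons_measure.

Fixpoint lebesgue_rV (R : realType) (n : nat) : set 'rV[R]_n -> \bar R :=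
  match n with
  | 0 => \d_(0 : 'rV[R]_0)
  | m.+1 => pushforward (lebesgue_measure \x @lebesgue_rV R m)%E rV_cons
  end.

Section lebesgue_rV_measure.
Context {R : realType} (n : nat).

Let lebesgue_rV_ex : exists mu : {sigma_finite_measure set 'rV[R]_n -> \bar R},
  @lebesgue_rV R n = mu.
Proof.
elim: n => [|m [mu IH]]; first by exists (\d_(0 : 'rV[R]_0)).
by exists (cons_measure mu); rewrite /= IH.
Qed.

Let lebesgue_rV0 : @lebesgue_rV R n set0 = 0%E.
Proof. by have [mu ->] := lebesgue_rV_ex; exact: measure0. Qed.

Let lebesgue_rV_ge0 A : (0 <= @lebesgue_rV R n A)%E.
Proof. by have [mu ->] := lebesgue_rV_ex; exact: measure_ge0. Qed.

Let lebesgue_rV_sigma_additive : semi_sigma_additive (@lebesgue_rV R n).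
Proof.
by have [mu ->] := lebesgue_rV_ex; exact: measure_semi_sigma_additive.
Qed.

HB.instance Definition _ := isMeasure.Build _ _ _ (@lebesgue_rV R n)
  lebesgue_rV0 lebesgue_rV_ge0 lebesgue_rV_sigma_additive.

Let lebesgue_rV_sigma_finite : sigma_finite setT (@lebesgue_rV R n).
Proof. by have [mu ->] := lebesgue_rV_ex; exact: sigma_finiteT. Qed.

HB.instance Definition _ := Measure_isSigmaFinite.Build _ _ _
  (@lebesgue_rV R n) lebesgue_rV_sigma_finite.

End lebesgue_rV_measure.

(* Points of R^n x R^n x R with coordinates (x, y, t).  The last factor is R
   itself: [measurableTypeR R] is the copy of R on which the library puts the
   sigma-algebra carrying [lebesgue_measure]. *)
Notation heis R n := ('rV[R]_n * 'rV[R]_n * measurableTypeR R)%type.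

Section heisenberg.
Context {R : realType} {n : nat}.
Implicit Types p q : heis R n.

Definition hx p (i : 'I_n) : R := p.1.1 ord0 i.
Definition hy p (i : 'I_n) : R := p.1.2 ord0 i.

Definition heis_mul p q : heis R n :=
  (p.1.1 + q.1.1, p.1.2 + q.1.2,
   (p.2 : R) + q.2 + 2^-1 * \sum_(i < n) (hx p i * hy q i - hy p i * hx q i)).

Definition hX (i : 'I_n) p : heis R n := (delta_mx ord0 i, 0, - (hy p i / 2)).
Definition hY (i : 'I_n) p : heis R n := (0, delta_mx ord0 i, hx p i / 2).

Definition heis_lebesgue : set (heis R n) -> \bar R :=
  (@lebesgue_rV R n \x @lebesgue_rV R n \x lebesgue_measure)%E.

HB.instance Definition _ := Measure.on heis_lebesgue.

End heisenberg.

Section left_invariance.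
Context {R : realType} {n : nat} (g p : heis R n).

Let is_derive_heis_mul (v : heis R n) : is_derive p v (heis_mul g)
  (v.1.1, v.1.2,
   (v.2 : R) + 2^-1 * \sum_(i < n) (hx g i * hy v i - hy g i * hx v i)).
Proof.
set w := (X in is_derive _ _ _ X).
have affine (h : R) : heis_mul g (h *: v + p) - heis_mul g p = h *: (w : heis R n).
  congr (_, _, _); rewrite /=.
  - by apply/rowP => i; rewrite !mxE; ring.
  - by apply/rowP => i; rewrite !mxE; ring.
  - pose om (q : heis R n) := \sum_(i < n) (hx g i * hy q i - hy g i * hx q i).
    have omE : om (h *: v + p) = h * om v + om p.
      rewrite /om mulr_sumr -big_split; apply: eq_bigr => i _ /=.
      by rewrite /hx /hy !mxE; ring.
    change ((g.2 : R) + (h * (v.2 : R) + (p.2 : R)) + 2^-1 * om (h *: v + p)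
      - ((g.2 : R) + (p.2 : R) + 2^-1 * om p) = h * ((v.2 : R) + 2^-1 * om v)).
    by rewrite omE; ring.
have E : (fun h : R => h^-1 *: ((heis_mul g \o shift p) (h *: v) - heis_mul g p))
    @ 0^' --> (w : heis R n).
  apply: cvg_near_cst; near=> h.
  have h0 : h != 0 by near: h; exact: nbhs_dnbhs_neq.
  by rewrite /= affine scalerA mulVf// scale1r.
split; first by apply/cvg_ex; exists w.
exact: cvg_lim.
Unshelve. all: by end_near.
Qed.

Lemma hX_left_invariant i :
  is_derive p (hX i p) (heis_mul g) (hX i (heis_mul g p)).
Proof.
apply: is_derive_eq; first exact: is_derive_heis_mul.
rewrite /hX /hx /hy; congr (_, _, _); rewrite /=.
rewrite (bigD1 i)//= big1 => [|j ji]; rewrite !mxE ?eqxx ?(negPf ji) /=; last by ring.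
by field.
Qed.

Lemma hY_left_invariant i :
  is_derive p (hY i p) (heis_mul g) (hY i (heis_mul g p)).
Proof.
apply: is_derive_eq; first exact: is_derive_heis_mul.
rewrite /hY /hx /hy; congr (_, _, _); rewrite /=.
rewrite (bigD1 i)//= big1 => [|j ji]; rewrite !mxE ?eqxx ?(negPf ji) /=; last by ring.
by field.
Qed.

End left_invariance.

Definition abs_continuous {R : realType} {V : normedModType R} (a b : R)
    (f : R -> V) :=
  forall e : R, 0 < e -> exists2 d : R, 0 < d &
    forall (m : nat) (u v : 'I_m -> R),
      (forall k, [/\ a <= u k, u k <= v k & v k <= b]) ->
      trivIset setT (fun k => `]u k, v k[%classic) ->
      \sum_(k < m) (v k - u k) < d ->
      \sum_(k < m) `|f (v k) - f (u k)| < e.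

Section carnot_caratheodory.
Context {R : realType} {n : nat}.
Implicit Types p q : heis R n.

(* The curve on [0, 1] is the restriction of [gamma]; the derivative at the two
   endpoints is irrelevant, since they form a null set. *)
Definition horizontal (gamma : R -> heis R n) (a b : 'I_n -> R -> R) :=
  [/\ abs_continuous 0 1 gamma,
      (forall i, measurable_fun (`[0, 1] : set R) (a i)),
      (forall i, measurable_fun (`[0, 1] : set R) (b i)) &
      {ae lebesgue_measure, forall s : R, s \in `[0, 1] ->
        is_derive s 1 gamma
          (\sum_(i < n) (a i s *: hX i (gamma s) + b i s *: hY i (gamma s)))}].

Definition horizontal_length (a b : 'I_n -> R -> R) : \bar R :=
  (\int[lebesgue_measure]_(s in `[0%R, 1%R])
    (Num.sqrt (\sum_(i < n) (a i s ^+ 2 + b i s ^+ 2)))%:E)%E.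

(* Extended-real valued: +oo would mean that no horizontal curve joins p to q. *)
Definition cc_dist p q : \bar R :=
  ereal_inf [set l | exists gamma a b,
    [/\ horizontal gamma a b, gamma 0 = p, gamma 1 = q &
        l = horizontal_length a b]].

Definition cc_ball p (r : R) : set (heis R n) :=
  [set q | (cc_dist p q < r%:E)%E].

End carnot_caratheodory.

Section wasserstein.
Context {d : measure_display} {T : measurableType d} {R : realType}.
Implicit Types mu nu : set T -> \bar R.

Definition coupling mu nu (xi : probability (T * T)%type R) :=
  forall A, measurable A -> xi (A `*` setT) = mu A /\ xi (setT `*` A) = nu A.

Definition wasserstein1 (dist : T -> T -> \bar R) mu nu : \bar R :=
  ereal_inf [set (\int[xi]_z dist z.1 z.2)%E | xi in coupling mu nu].

End wasserstein.

Section coarse_ricci.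
Context {R : realType} {n : nat}.
Implicit Types x y : heis R n.

(* The measure with density 1_B / nu(B), B being the ball of radius r at x. *)
Definition walk (r : R) x (A : set (heis R n)) : \bar R :=
  (\int[heis_lebesgue]_(z in A)
    ((\1_(cc_ball x r) z)%:E / heis_lebesgue (cc_ball x r)))%E.

Definition coarse_ricci (r : R) x y : \bar R :=
  (1 - wasserstein1 cc_dist (walk r x) (walk r y) / cc_dist x y)%E.

End coarse_ricci.

(* Main.v *)
(** Write d for the distance of x and y, B for a ball of radius r, nu for the
    Lebesgue measure and Q = 2n + 2. Leave the mass common to the two walks where
    it is and couple the rest arbitrarily: no point moves by more than 2r + d, so
    W_1 <= (2r + d) nu(B_r(x) \ B_r(y)) / nu(B). Left translations preserve nu and
    the distance, and dilations by l scale them by l^Q and l; since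
    B_(r-d)(x) is contained in B_r(y), the quotient is at most
    min(1, 1 - (1 - d/r)^Q) <= min(1, Q d / r). The bound 1 suffices when
    2r <= (2Q + 1) d and the bound Q d / r otherwise, because
    2 (2n + 3) = 2 (Q + 1).

    For the walks to be probability measures, balls must be measurable with
    positive finite measure. They are open because horizontal lines and
    their commutators join 0 to (x, y, t) at cost |x| + |y| + 4 sqrt |t|; they are
    bounded because an absolutely continuous function with |f'| <= g almost
    everywhere satisfies |f(t) - f(0)| <= int g. *)

From HB Require Import structures.
Require Import Defs.
From mathcomp Require Import all_boot all_order all_algebra.
From mathcomp Require Import all_classical all_reals all_analysis.
From mathcomp Require Import measurable_realfun.
From mathcomp Require Import ring lra.

Set Implicit Arguments.
Unset Strict Implicit.
Unset Printing Implicit Defensive.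

Import Order.TTheory GRing.Theory Num.Theory.
Import numFieldNormedType.Exports.

Local Open Scope classical_set_scope.
Local Open Scope ring_scope.

(** How the constant arises: if 2r <= (2Q + 1) d, then 2r + d <= 2 (Q + 1) d and the quotient bound
    1 is enough; otherwise Q d <= 2r, so (2r + d) Q d / r = 2Q d + (Q d / r) d is again at most 2 (Q
    + 1) d. The distance is an infimum in the extended reals, and neither its measurability nor
    separation of points is established. The cost of the coupling is therefore compared with a
    measurable function which is infinite only on a set of coupling mass zero, and the values 0 and
    +oo of d are treated at the end by the conventions for division. Curves have a prescribed
    velocity only almost everywhere. Bounding a ball thus requires that a null set of times
    contribute nothing to the motion; this is what the Cantor function violates and where absolute
    continuity enters. Translations and dilations are affine maps whose linear part multiplies the
    horizontal frame by a constant, so [cc_dist_map] settles their effect on d and [heis_affine]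
    their effect on nu. *)

(** Clearing the denominator of the difference quotient gives a form that also allows x = s. Chain
    rules and comparisons of increments then need no passage to the limit. *)
Lemma is_derive1P (R : realType) (V : normedModType R) (f : R -> V) (s : R)
    (v : V) :
  is_derive s 1 f v <->
  forall e, 0 < e -> exists2 eta, 0 < eta &
    forall x, `|x - s| < eta -> `|f x - f s - (x - s) *: v| <= e * `|x - s|.
Proof.
have E (h : R) : h != 0 ->
    `|v - h^-1 *: (f (h + s) - f s)| = `|h|^-1 * `|f (h + s) - f s - h *: v|.
  move=> h0; rewrite -normfV -normrZ; rewrite distrC; congr (`| _ |).
  by rewrite [in RHS]scalerBr scalerA mulVf// scale1r.
split=> [[df vE] e e0|H].
- have {}df : h^-1 *: (f (h + s) - f s) @[h --> 0^'] --> v.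
    move: df; rewrite /derivable -vE => df.
    rewrite (_ : (fun h => _) = (fun h => h^-1 *: ((f \o shift s) (h *: 1) - f s))).
      exact: df.
    by apply/funext => h /=; rewrite scaler1.
  move/cvgrPdist_le : df => /(_ _ e0).
  rewrite near_withinE => /nbhs_ballP[eta /= eta0 H]; exists eta => // x xs.
  have [->|xs0] := eqVneq x s; first by rewrite !subrr scale0r subrr !normr0 mulr0.
  have h0 : x - s != 0 by rewrite subr_eq0.
  have := H (x - s); rewrite /ball /= sub0r normrN => /(_ xs h0).
  by rewrite E// subrK ler_pdivrMl ?normr_gt0// mulrC.
- have cv : h^-1 *: ((f \o shift s) (h *: 1) - f s) @[h --> 0^'] --> v.
    apply/cvgrPdist_le => e e0; have [eta eta0 K] := H e e0.
    rewrite near_withinE; apply/nbhs_ballP; exists eta => //= h.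
    rewrite /ball /= sub0r normrN => heta h0.
    rewrite scaler1 E// ler_pdivrMl ?normr_gt0//.
    by have := K (h + s); rewrite addrK mulrC; apply.
  split; last exact: cvg_lim.
  by apply/cvg_ex; exists v.
Qed.

(** * Absolutely continuous functions *)

Section abs_continuous_bound.
Context {R : realType}.
Notation mu := (@lebesgue_measure R).

(* Cousin's lemma, with the tag of each interval already forgotten. *)
Lemma cousin_partition (P : R -> R -> Prop) (T : R) : 0 <= T ->
  (forall s, 0 <= s <= T -> exists2 eta, 0 < eta &
    forall x y, 0 <= x -> x <= s -> s <= y -> y <= T ->
      s - x < eta -> y - s < eta -> P x y) ->
  exists m (t : nat -> R), [/\ t 0%N = 0, t m = T,
    {homo t : i j / (i <= j)%N >-> i <= j} &
    forall k, (k < m)%N -> P (t k) (t k.+1)].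
Proof.
move=> T0 loc.
pose Q x := exists m (t : nat -> R), [/\ t 0%N = 0, t m = x,
  {homo t : i j / (i <= j)%N >-> i <= j} &
  forall k, (k < m)%N -> P (t k) (t k.+1)].
have Qext x y : Q x -> x <= y -> P x y -> Q y.
  move=> [m [t [t00 tm th tP]]] xy Pxy.
  exists m.+1, (fun k => if (k <= m)%N then t k else y); split => //.
  - by rewrite ltnn.
  - move=> i j ij; case: leqP => im; case: leqP => jm //; first exact: th.
      by rewrite (le_trans _ xy)// -tm th.
    by move: (leq_trans im ij); rewrite ltnNge jm.
  - move=> k; rewrite ltnS => km; rewrite km; case: ltnP => km'; first exact: tP.
    have -> : k = m by apply/eqP; rewrite eqn_leq km.
    by rewrite tm.
(* At the supremum s of the reachable end points, the gauge bridges from a point of S just below s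
   to a point beyond s, so s < T is impossible. *)
pose S := [set x | 0 <= x <= T /\ Q x].
have Q0 : Q 0 by exists 0%N, (fun=> 0); split.
have S0 : S 0 by split; [rewrite lexx|].
have Sub : ubound S T by move=> x [/andP[]].
have hS : has_sup S by split; [exists 0|exists T].
set s := sup S.
have s0T : 0 <= s <= T.
  apply/andP; split; first exact: (ub_le_sup (proj2 hS)).
  by apply: ge_sup => //; exists 0.
have [eta eta0 H] := loc s s0T.
have [x [/andP[x0 xT] Qx] sx] := sup_adherent eta0 hS.
have xs : x <= s by apply: (ub_le_sup (proj2 hS)); split => //; rewrite x0.
have /andP[s0 sT] := s0T.
pose y := Num.min (s + eta / 2) T.
have sy : s <= y by rewrite le_min sT andbT lerDl ltW// divr_gt0.
have yT : y <= T by rewrite ge_min lexx orbT.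
have Qy : Q y.
  apply: (Qext x) => //; first exact: le_trans xs sy.
  apply: H => //; first by move: sx; rewrite -/s; lra.
  suff : y <= s + eta / 2 by lra.
  by rewrite ge_min lexx.
have : y <= s by apply: (ub_le_sup (proj2 hS)); split => //; rewrite (le_trans s0).
rewrite /y ge_min => /orP[|Ts]; first by lra.
have yE : y = T by apply/eqP; rewrite eq_le yT (le_trans Ts sy).
by move: Qy; rewrite yE.
Qed.

Lemma sum_itv_length_le (m : nat) (u v : 'I_m -> R) (O : set R) :
  (forall k, u k <= v k) -> trivIset setT (fun k => `]u k, v k[%classic) ->
  measurable O -> (forall k, `]u k, v k[%classic `<=` O) ->
  ((\sum_(k < m) (v k - u k))%:E <= mu O)%E.
Proof.
move=> uv tI mO sub.
rewrite -sumEFin.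
have -> : (\sum_(k < m) (v k - u k)%:E = \sum_(k < m) mu `]u k, v k[%classic)%E.
  apply: eq_bigr => k _; rewrite lebesgue_measure_itv/= lte_fin.
  case: ltP => // vu; have -> : v k = u k by apply/eqP; rewrite eq_le vu uv.
  by rewrite subrr.
rewrite -(measure_bigsetU_ord _ xpredT)//.
apply: le_measure; rewrite ?inE//; first exact: bigsetU_measurable.
by rewrite -bigcup_seq => x [k _]; exact: sub.
Qed.

(* With G the primitive of g, each point either has a neighbourhood on which the
   increments of f are dominated by those of G up to e, or lies in a null set,
   hence in an open set W so small that f varies by less than e on disjoint
   intervals of W. A Cousin partition mixes the two estimates. *)
Lemma abs_continuous_le_integral (f g : R -> R) (T : R) :
  abs_continuous 0 1 f ->
  mu.-integrable `[0, 1] (EFin \o g) -> (forall s, 0 <= g s) ->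
  {ae mu, forall s : R, s \in `[0, 1] ->
    exists2 v : R, is_derive s 1 f v & `|v| <= g s} ->
  0 <= T <= 1 -> `|f T - f 0| <= \int[mu]_(x in `[0, 1]) g x.
Proof.
move=> acf ig g0 aef /andP[T0 T1].
have m01 : measurable (`[0, 1]%classic : set R) by exact: measurable_itv.
(* Extended by zero, g is integrable on the whole line; its primitive G from -oo is nondecreasing
   everywhere and has derivative h almost everywhere. *)
pose h := g \_ `[0, 1].
have h0 x : 0 <= h x by rewrite /h patchE; case: ifP.
have ih : mu.-integrable setT (EFin \o h).
  by move/integrable_mkcond : ig => /(_ m01); rewrite restrict_EFin.
have ihy y : mu.-integrable `]-oo, y] (EFin \o h) by exact: integrableS ih.
pose G x := \int[mu]_(t in `]-oo, x]) h t.
have hG : {ae mu, forall x : R, derivable G x 1 /\ derive1 G x = h x}.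
  by apply: FTC1Ny => //; exact: integrable_locally.
have Gmono x y : x <= y -> G x <= G y.
  move=> xy; rewrite /G /Rintegral fine_le ?integrable_fin_num//.
  apply: ge0_subset_integral => //=.
  - by apply/measurable_EFinP; have /integrableP[/measurable_EFinP] := ihy y.
  - by move=> z _; rewrite lee_fin.
  - by apply: subset_itvl; rewrite bnd_simp.
have GT : G T - G 0 <= \int[mu]_(x in `[0, 1]) g x.
  have G0 : 0 <= G 0 by apply: Rintegral_ge0 => x _.
  suff : G T <= \int[mu]_(x in `[0, 1]) g x by lra.
  have -> : \int[mu]_(x in `[0, 1]) g x = \int[mu]_x h x.
    by rewrite /Rintegral integral_mkcond restrict_EFin.
  rewrite /G /Rintegral fine_le ?integrable_fin_num//.
  apply: ge0_subset_integral => //=.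
  - by apply/measurable_EFinP; have /integrableP[/measurable_EFinP] := ih.
  - by move=> z _; rewrite lee_fin.
apply: (le_trans _ GT).
apply/ler_addgt0Pl => e0 e0_gt0.
(* One half of [e0] pays for the variation of f on intervals inside W, the other for the linear
   error [e * T]. *)
pose e := e0 / 2; have e_gt0 : 0 < e by rewrite divr_gt0.
have [d d0 acfd] := acf _ e_gt0.
pose good (s : R) := (s \in `[0, 1] -> exists2 v : R, is_derive s 1 f v & `|v| <= g s)
  /\ (derivable G s 1 /\ derive1 G s = h s).
have : {ae mu, forall s : R, good s}.
  have ? := ae_filter_ringOfSetsType mu.
  by apply: filterS2 aef hG => s; split.
move=> [N' [mN' N'0 subN']].
have negN : mu.-negligible (~` [set s | good s]) by exists N'.
have out0 := proj1 (negligible_outer_measure _) negN.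
have d20 : 0 < d / 2 by rewrite divr_gt0.
have [W [oW NO muW]] := outer_measure_open_le (~` [set s | good s]) d20.
rewrite out0 add0e in muW.
have mO : measurable W by exact: open_measurable.
pose gd x y := `|f y - f x| <= G y - G x + e * (y - x).
have [|m [t [t0 tm tmono tP]]] :=
    @cousin_partition (fun x y : R => gd x y \/ `[x, y]%classic `<=` W) T T0.
  move=> s /andP[s0 sT].
  have [gs|ngs] := pselect (good s); last first.
    have /NO Os : (~` [set s | good s]) s by [].
    have /nbhs_ballP[eta /= eta0 H] : nbhs s W by exact: open_nbhs_nbhs.
    exists eta => // x y _ xs sy _ sx ys; right => z /=.
    rewrite in_itv/= => /andP[xz zy]; apply: H; rewrite /ball/=.
    by rewrite ltr_norml; apply/andP; split; lra.
  have [+ [dG G's]] := gs.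
  have s01 : s \in `[0, 1] by rewrite in_itv/= s0 (le_trans sT).
  move=> /(_ s01) [v /is_derive1P fv vg].
  have /is_derive1P Gv : is_derive s 1 G (g s).
    split => //; rewrite -derive1E G's /h patchE mem_set//.
  have e20 : 0 < e / 2 by rewrite divr_gt0.
  have [eta1 eta10 H1] := fv _ e20; have [eta2 eta20 H2] := Gv _ e20.
  exists (Num.min eta1 eta2); first by rewrite lt_min eta10.
  move=> x y x0 xs sy yT; rewrite !lt_min => /andP[sx1 sx2] /andP[sy1 sy2]; left.
  have nx : `|x - s| = s - x by rewrite distrC ger0_norm// subr_ge0.
  have ny : `|y - s| = y - s by rewrite ger0_norm// subr_ge0.
  have := H1 x; rewrite nx => /(_ sx1).
  have := H2 x; rewrite nx => /(_ sx2).
  have := H1 y; rewrite ny => /(_ sy1).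
  have := H2 y; rewrite ny => /(_ sy2).
  rewrite /gd /GRing.scale/=.
  have vb (w : R) : 0 <= w -> `|w * v| <= w * g s.
    by move=> w0; rewrite normrM ger0_norm// ler_wpM2l.
  have := vb (y - s); rewrite subr_ge0 => /(_ sy).
  have := vb (s - x); rewrite subr_ge0 => /(_ xs).
  rewrite !ler_norml => /andP[? ?] /andP[? ?] /andP[? ?] /andP[? ?].
  by move=> /andP[? ?] /andP[? ?]; apply/andP; split; lra.
pose bad k := `[t k, t k.+1]%classic `<=` W.
(* An interval not contained in W is collapsed to a point, so that absolute continuity applies to a
   single family indexed by all k < m. *)
pose v k := if pselect (bad k) then t k.+1 else t k.
have vle (k : nat) : t k <= v k <= t k.+1.
  by rewrite /v; case: pselect => ?; rewrite lexx tmono.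
have tle (k : nat) : (k <= m)%N -> 0 <= t k <= T.
  by move=> km; rewrite -t0 -tm !tmono.
pose U (k : 'I_m) := t k; pose V (k : 'I_m) := v k.
have tI : trivIset setT (fun k => `]U k, V k[%classic).
  apply/trivIsetP => i j _ _ ij.
  wlog lij : i j ij / (i < j)%N.
    move=> wl; move: (ij); rewrite -val_eqE neq_ltn => /orP[|] ?; first exact: wl.
    by rewrite setIC; apply: wl => //; rewrite eq_sym.
  rewrite -subset0 => z [/=]; rewrite !in_itv/= => /andP[_ zV] /andP[Uz _].
  have := lt_trans Uz zV; rewrite /U /V ltNge => /negP; apply.
  by have /andP[_ /le_trans] := vle i; apply; exact: tmono.
have : \sum_(k < m) `|f (V k) - f (U k)| < e.
  apply: acfd => //.
  - move=> k; have /andP[a b] := tle k (ltnW (ltn_ord k)).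
    have /andP[c' d'] := tle k.+1 (ltn_ord k).
    have /andP[a' b'] := vle k; split => //.
    by rewrite (le_trans b')// (le_trans d').
  - rewrite -lte_fin; apply: le_lt_trans (sum_itv_length_le _ tI mO _) _.
    + by move=> k; have /andP[] := vle k.
    + move=> k z /=; rewrite /V /v; case: pselect => [b|?]; last first.
        by rewrite in_itv/= => /andP[/lt_trans a /a]; rewrite ltxx.
      by move/subset_itv_oo_cc; exact: b.
    + by apply: le_lt_trans muW _; rewrite lte_fin; lra.
move=> sumlt.
have step (k : 'I_m) : `|f (t k.+1) - f (t k)| <=
    `|f (V k) - f (U k)| + (G (t k.+1) - G (t k) + e * (t k.+1 - t k)).
  have [] := tP k (ltn_ord k).
    by move=> /le_trans; apply; rewrite lerDr.
  move=> b; rewrite /V /v; case: pselect => // ?; rewrite lerDl.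
  by rewrite addr_ge0// ?subr_ge0 ?Gmono ?mulr_ge0 ?subr_ge0 ?tmono// ltW.
have : `|f T - f 0| <= \sum_(k < m) `|f (t k.+1) - f (t k)|.
  have -> : f T - f 0 = \sum_(k < m) (f (t k.+1) - f (t k)).
    by rewrite -(big_mkord xpredT (fun k => f (t k.+1) - f (t k)))
      (telescope_sumr (fun k => f (t k)))// t0 tm.
  exact: ler_norm_sum.
move=> /le_trans; apply.
apply: (le_trans (ler_sum _ (fun k _ => step k))).
rewrite big_split/= big_split/= -mulr_sumr.
rewrite -(big_mkord xpredT (fun k => G (t k.+1) - G (t k))).
rewrite -(big_mkord xpredT (fun k => t k.+1 - t k)).
rewrite (telescope_sumr (fun k => G (t k)))// (telescope_sumr t)// t0 tm subr0.
have : e * T <= e by rewrite ler_piMr// ltW.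
move: sumlt; rewrite /e; lra.
Qed.
End abs_continuous_bound.

(** * Scaling of measures *)

(** Preimages are measured, so c is the inverse of the usual Jacobian factor. *)
Definition scales d (T : measurableType d) (R : realType) (mu : set T -> \bar R)
    (f : T -> T) (c : R) :=
  [/\ 0 <= c, measurable_fun setT f &
      forall A, measurable A -> mu (f @^-1` A) = (c%:E * mu A)%E].

Section scales.
Context d (T : measurableType d) (R : realType) (mu : {measure set T -> \bar R}).

Lemma scales_integral (f : T -> T) (c : R) (h : T -> \bar R) :
  scales mu f c -> measurable_fun setT h -> (forall x, 0 <= h x)%E ->
  (\int[mu]_x h (f x) = c%:E * \int[mu]_x h x)%E.
Proof.
move=> [c0 mf fA] mh h0.
rewrite -[LHS]/(\int[mu]_(x in f @^-1` setT) (h \o f) x)%E.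
rewrite -(ge0_integral_pushforward mf)//.
rewrite (eq_measure_integral (mscale (NngNum c0) mu) (m1 :=
  measure_function_pushforward__canonical__measure_function_Measure mu mf)).
  by rewrite ge0_integral_mscale.
by move=> A mA _; exact: fA.
Qed.

Lemma scales_negligible (f : T -> T) (c : R) (N : set T) :
  scales mu f c -> mu.-negligible N -> mu.-negligible (f @^-1` N).
Proof.
move=> [c0 mf fA] [A [mA A0 NA]]; exists (f @^-1` A); split.
- by rewrite -[X in measurable X]setTI; exact: mf.
- by rewrite fA// A0 mule0.
- by move=> x /NA.
Qed.

End scales.

(** By Tonelli: the section at x of the preimage of A is the preimage under [g x] of the section of
    A at [f x]. Letting g depend on x admits shears, which group translations are in the
    t-direction. *)
Lemma scales_prod d1 d2 (T1 : measurableType d1) (T2 : measurableType d2)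
    (R : realType) (m1 : {measure set T1 -> \bar R})
    (m2 : {sigma_finite_measure set T2 -> \bar R})
    (f : T1 -> T1) (g : T1 -> T2 -> T2) (c1 c2 : R) :
  scales m1 f c1 -> (forall x, scales m2 (g x) c2) -> 0 <= c2 ->
  measurable_fun setT (fun z : T1 * T2 => g z.1 z.2) ->
  scales (m1 \x m2)%E (fun z => (f z.1, g z.1 z.2)) (c1 * c2).
Proof.
move=> sf sg c20 mg; have [c10 mf fA] := sf; split.
- exact: mulr_ge0.
- apply/measurable_fun_pairP; split; last exact: mg.
  exact: (measurableT_comp mf measurable_fst).
- move=> A mA; rewrite /product_measure1 EFinM.
  transitivity (\int[m1]_x (c2%:E * (m2 \o xsection A) (f x)))%E.
    apply: eq_integral => x _ /=; have [_ _ gA] := sg x.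
    rewrite -gA; last exact: measurable_xsection.
    by congr (m2 _); apply/seteqP; split=> y; rewrite /xsection /= !inE.
  have mx := measurable_fun_xsection m2 mA.
  rewrite ge0_integralZl//; first last.
  - exact: (measurableT_comp mx mf).
  by rewrite (scales_integral sf)// muleA (muleC c2%:E).
Qed.

(** * Affine maps and Lebesgue measure *)

Section lebesgue_scales.
Context {R : realType}.

(** [|a|] times the push-forward gives half-open intervals their length, hence is Lebesgue measure
    by uniqueness. *)
Lemma lebesgue_affine (a b : R) : a != 0 ->
  scales (@lebesgue_measure R)
    (fun x : measurableTypeR R => a * (x : R) + b : measurableTypeR R) `|a|^-1.
Proof.
move=> a0; pose f (x : measurableTypeR R) : measurableTypeR R := a * (x : R) + b.
have mf : measurable_fun setT f by apply: measurable_funD => //; exact: mulrl_measurable.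
split => // A mA.
pose m' : {measure set (measurableTypeR R) -> \bar R} :=
  mscale (NngNum (normr_ge0 a))
    (measure_function_pushforward__canonical__measure_function_Measure
      (@lebesgue_measure R) mf).
rewrite (@lebesgue_measure_unique _ m' _ _ mA); last first.
  move=> _ [[u v] _ <-].
  change (lebesgue_measure `]u, v]%classic =
    `|a|%:E * lebesgue_measure (f @^-1` `]u, v]%classic))%E.
  (* The first case is a < 0: the preimage of a half-open interval is then closed at the other
     end. *)
  have [a_gt0|a_lt0|a00] := ltgtP a 0; last by rewrite a00 eqxx in a0.
  - have -> : f @^-1` `]u, v] = `[(v - b) / a, (u - b) / a[%classic.
      apply/seteqP; split => x; rewrite /f /= !in_itv/=.
        by move=> /andP[? ?]; apply/andP; split; rewrite ?ler_ndivrMr ?ltr_ndivlMr//; lra.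
      by rewrite ler_ndivrMr ?ltr_ndivlMr// => /andP[? ?]; apply/andP; split; lra.
    rewrite !lebesgue_measure_itv/= !lte_fin ltr_nM2r ?invr_lt0//.
    rewrite ltrD2r; case: ifPn => uv; last by rewrite mule0.
    rewrite -!EFinD -EFinM; congr (_%:E); rewrite ltr0_norm//; by field; rewrite lt_eqF.
  - have -> : f @^-1` `]u, v] = `](u - b) / a, (v - b) / a]%classic.
      apply/seteqP; split => x; rewrite /f /= !in_itv/=.
        by move=> /andP[? ?]; apply/andP; split; rewrite ?ler_pdivlMr ?ltr_pdivrMr//; lra.
      by rewrite ler_pdivlMr ?ltr_pdivrMr// => /andP[? ?]; apply/andP; split; lra.
    rewrite !lebesgue_measure_itv/= !lte_fin ltr_pM2r ?invr_gt0//.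
    rewrite ltrD2r; case: ifPn => uv; last by rewrite mule0.
    rewrite -!EFinD -EFinM; congr (_%:E); rewrite gtr0_norm//; by field; rewrite gt_eqF.
rewrite /m' /mscale /pushforward /= muleA -EFinM mulVf ?normr_eq0// mul1e.
by [].
Qed.

Lemma lebesgue_rV_affine (n : nat) (a : R) (w : 'rV[R]_n) : a != 0 ->
  scales (@lebesgue_rV R n) (fun v => a *: v + w) (`|a|^-1 ^+ n).
Proof.
move=> a0; elim: n w => [|n IH] w.
  split; first by rewrite expr0.
  - by apply/measurable_fun_rVP => -[].
  - move=> A mA; rewrite expr0 mul1e.
    rewrite (_ : (fun v => _) = id) ?preimage_id//.
    by apply/funext => v; apply/rowP => -[].
have mf : measurable_fun setT (fun v : 'rV[R]_n.+1 => a *: v + w).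
  apply/measurable_fun_rVP => i.
  rewrite (_ : _ \o _ =
      fun v : 'rV[R]_n.+1 => a * v ord0 i + w ord0 i : measurableTypeR R).
    apply: measurable_funD => //; apply: measurable_funM => //.
    exact: measurable_coord.
  by apply/funext => v; rewrite /= !mxE.
split; [by rewrite exprn_ge0|exact: mf|move=> A mA /=].
pose w' : 'rV[R]_n := \row_j w ord0 (lift ord0 j).
have sP := @scales_prod _ _ _ _ _ (@lebesgue_measure R) (@lebesgue_rV R n) _ _ _ _
  (lebesgue_affine (w ord0 ord0) a0) (fun=> IH w').
have [] := sP; rewrite ?exprn_ge0//.
  by have [_ m _] := IH w'; exact: (measurableT_comp m measurable_snd).
move=> _ _ E; rewrite exprS /pushforward.
rewrite -E; last by rewrite -[X in measurable X]setTI; exact: measurable_rV_cons.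
congr (product_measure1 _ _ _); apply/seteqP.
have H (z : measurableTypeR R * 'rV[R]_n) :
    a *: rV_cons z + w = rV_cons (a * (z.1 : R) + w ord0 ord0, a *: z.2 + w').
  case: z => t v; apply/rowP => i; rewrite /rV_cons.
  case: (@split_ordP 1 n i) => j ->; rewrite [LHS]mxE [X in X + _]mxE.
    rewrite !(@row_mxEl _ _ 1 n) !mxE; congr (_ + w _ _).
    by apply: val_inj; rewrite /= ord1.
  rewrite !(@row_mxEr _ _ 1 n) !mxE; congr (_ + w _ _).
  exact: val_inj.
by split=> z; rewrite /= H.
Qed.

(** Left translations are the case a = b = 1 with [tau] the shear of the group law; dilations by l
    are the case a = l, b = l^2, [tau] = 0. *)
Lemma heis_affine (n : nat) (a b : R) (x0 y0 : 'rV[R]_n)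
    (tau : 'rV[R]_n * 'rV[R]_n -> R) : a != 0 -> b != 0 ->
  measurable_fun setT (tau : _ -> measurableTypeR R) ->
  scales (@heis_lebesgue R n)
    (fun p => (a *: p.1.1 + x0, a *: p.1.2 + y0,
      b * (p.2 : R) + tau p.1 : measurableTypeR R))
    (`|a|^-1 ^+ n * `|a|^-1 ^+ n * `|b|^-1).
Proof.
move=> a0 b0 mtau.
have sx := lebesgue_rV_affine x0 a0; have sy := lebesgue_rV_affine y0 a0.
have sxy := scales_prod sx (fun=> sy).
have {}sxy : scales (@lebesgue_rV R n \x @lebesgue_rV R n)%E
    (fun z => (a *: z.1 + x0, a *: z.2 + y0)) (`|a|^-1 ^+ n * `|a|^-1 ^+ n).
  apply: sxy; first by rewrite exprn_ge0.
  by have [_ m _] := sy; exact: (measurableT_comp m measurable_snd).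
have := scales_prod sxy (fun z => lebesgue_affine (tau z) b0); apply.
  by rewrite invr_ge0.
apply: measurable_funD => /=.
  apply: (measurable_funM (measurable_cst _)).
  exact: (measurable_snd : measurable_fun setT (@snd _ (measurableTypeR R))).
exact: (measurableT_comp mtau measurable_fst).
Qed.

End lebesgue_scales.

(** * Coordinate boxes, measurability and sigma-finiteness *)

Section heis_box.
Context {R : realType} {n : nat}.

Definition rV_box m (c : 'rV[R]_m) (e : R) : set 'rV[R]_m :=
  [set v | forall i, `|v ord0 i - c ord0 i| < e].

Lemma measurable_rV_box m (c : 'rV[R]_m) e : measurable (rV_box c e).
Proof.
rewrite (_ : rV_box c e = \bigcap_(i in [set: 'I_m])
    ((fun v : 'rV[R]_m => v ord0 i : measurableTypeR R) @^-1` ball (c ord0 i) e)).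
  apply: fin_bigcap_measurable => // i _.
  rewrite -[X in measurable X]setTI; apply: measurable_coord => //.
  exact: measurable_ball.
apply/seteqP; split => v; rewrite /rV_box /=.
  by move=> H i _; rewrite /ball/= distrC; exact: H.
by move=> H i; have := H i I; rewrite /ball/= distrC.
Qed.

Definition heis_box (p : heis R n) (e : R) : set (heis R n) :=
  [set q | [/\ forall i, `|hx q i - hx p i| < e,
               forall i, `|hy q i - hy p i| < e &
               `|(q.2 : R) - (p.2 : R)| < e]].

Lemma heis_boxE p e : heis_box p e =
  (rV_box p.1.1 e `*` rV_box p.1.2 e) `*` (ball (p.2 : R) e : set (measurableTypeR R)).
Proof.
apply/seteqP; split => q; rewrite /heis_box /rV_box /ball /= distrC.
  by case.
by case=> -[].
Qed.

Lemma measurable_heis_box p e : measurable (heis_box p e).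
Proof.
rewrite heis_boxE; apply: measurableX; last exact: measurable_ball.
by apply: measurableX; exact: measurable_rV_box.
Qed.

(** The boxes with rational centre and radius 1/(k+1) form a countable family, and U is the union of
    those it contains. This links openness to the sigma-algebra generated by the coordinates. *)
Lemma box_open_measurable (U : set (heis R n)) :
  (forall p, U p -> exists2 e, 0 < e & heis_box p e `<=` U) -> measurable U.
Proof.
move=> oU.
pose c (k : 'rV[rat]_n * 'rV[rat]_n * rat * nat) : heis R n :=
  (map_mx ratr k.1.1.1, map_mx ratr k.1.1.2, ratr k.1.2 : measurableTypeR R).
pose e (k : 'rV[rat]_n * 'rV[rat]_n * rat * nat) : R := k.2.+1%:R^-1.
pose F k := if pselect (heis_box (c k) (e k) `<=` U) then heis_box (c k) (e k)
  else set0.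
suff -> : U = \bigcup_k F k.
  apply: countable_bigcupT_measurable => // k; rewrite /F.
  by case: pselect => H; [exact: measurable_heis_box|exact: measurable0].

apply/seteqP; split => [p Up|p [k _]]; last first.
  by rewrite /F; case: pselect => [H /H|? []].
have [d d0 H] := oU p Up.
(* Twice the radius stays below d: once for the distance from p to the rational centre, once for the
   box around that centre. *)
have [k kd] : exists k : nat, k.+1%:R^-1 < d / 2.
  exists (Num.truncn (d / 2)^-1); rewrite invf_plt ?posrE ?divr_gt0//.
  exact: truncnS_gt.
have k0 : 0 < k.+1%:R^-1 :> R by rewrite invr_gt0.
have approx (x : R) : {q : rat | `|x - ratr q| < k.+1%:R^-1}.
  apply: cid.
  have xlt : x - k.+1%:R^-1 < x + k.+1%:R^-1 by move: k0; set z := _^-1; clearbody z; lra.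
  have [q] := rat_in_itvoo xlt.
  by rewrite in_itv/= => H1; exists q; rewrite ltr_distlC.
pose r (x : R) := sval (approx x).
have rP x : `|x - ratr (r x)| < k.+1%:R^-1 by exact: (svalP (approx x)).
have tri (x y : R) : `|y - ratr (r x)| < k.+1%:R^-1 -> `|y - x| < d.
  move=> yr; have := rP x; move: yr kd; rewrite !ltr_norml; clear.
  move: (_^-1) (ratr _) => z w /andP[? ?] ? /andP[? ?].
  by apply/andP; split; lra.
pose k' : 'rV[rat]_n * 'rV[rat]_n * rat * nat :=
  (\row_i r (hx p i), \row_i r (hy p i), r p.2, k).
exists k' => //; rewrite /F; case: pselect => [?|[]].
  by split => [i|i|]; rewrite /hx /hy /c /= ?mxE; exact: rP.
move=> q [qx qy qt]; apply: H; split => [i|i|]; apply: tri => //.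
- by have := qx i; rewrite /c /hx /= !mxE.
- by have := qy i; rewrite /c /hy /= !mxE.
Qed.

Lemma lebesgue_rV_box m (c : 'rV[R]_m) e : 0 < e ->
  lebesgue_rV (rV_box c e) =
  ((2 * e) ^+ m)%:E.
Proof.
move=> e0; elim: m c => [|m IH] c.
  rewrite /= diracE mem_set ?expr0//.
  by case.
pose c' : 'rV[R]_m := \row_j c ord0 (lift ord0 j).
rewrite exprS EFinM -(IH c') mulr_natl -(lebesgue_measure_ball (c ord0 ord0) (ltW e0)).
have mB : measurable (ball (c ord0 ord0) e : set (measurableTypeR R)).
  exact: measurable_ball.
rewrite -(product_measure1E lebesgue_measure (@lebesgue_rV R m) mB
  (measurable_rV_box c' e)).
rewrite /= /pushforward; congr (product_measure1 _ _ _).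
apply/seteqP; split => -[t v]; rewrite /rV_cons /ball/= => H.
  split.
    have := H ord0; have -> : ord0 = @lshift 1 m ord0 by exact: val_inj.
    by rewrite (row_mxEl (const_mx t : 'rV[R]_1) v) mxE distrC.
  move=> i; have := H (@rshift 1 m i).
  rewrite (row_mxEr (const_mx t : 'rV[R]_1) v) mxE.
  by have -> : lift ord0 i = @rshift 1 m i by exact: val_inj.
move=> i; case: (@split_ordP 1 m i) => j ->.
  rewrite (row_mxEl (const_mx t : 'rV[R]_1) v) mxE distrC.
  have -> : @lshift 1 m j = ord0 by apply: val_inj; rewrite /= ord1.
  exact: H.1.
rewrite (row_mxEr (const_mx t : 'rV[R]_1) v).
have := H.2 j; rewrite mxE.
by have -> : lift ord0 j = @rshift 1 m j by exact: val_inj.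
Qed.

Lemma heis_lebesgue_box p e : 0 < e ->
  heis_lebesgue (heis_box p e) = ((2 * e) ^+ (n + n).+1)%:E.
Proof.
move=> e0; rewrite heis_boxE.
have mx := measurable_rV_box p.1.1 e; have my := measurable_rV_box p.1.2 e.
have mt : measurable (ball (p.2 : R) e : set (measurableTypeR R)).
  exact: measurable_ball.
have E1 := product_measure1E (@lebesgue_rV R n) (@lebesgue_rV R n) mx my.
have E2 := product_measure1E (@lebesgue_rV R n \x @lebesgue_rV R n)%E
  (@lebesgue_measure R) (measurableX mx my) mt.
rewrite /heis_lebesgue {}E2 [X in (X * _)%E]E1.
transitivity (((2 * e) ^+ n)%:E * ((2 * e) ^+ n)%:E * (e *+ 2)%:E)%E.
  by congr (_ * _ * _)%E; [exact: lebesgue_rV_box|exact: lebesgue_rV_box|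
    apply: lebesgue_measure_ball; exact: ltW].
rewrite -!EFinM.
by rewrite exprSr exprD mulr_natl.
Qed.

(** Required to form the product of the measure with itself, on which the coupling of two walks is
    built. *)
Lemma heis_lebesgue_sigma_finite : sigma_finite setT (@heis_lebesgue R n).
Proof.
exists (fun k => heis_box 0 k.+1%:R) => [|k]; last first.
  split; first exact: measurable_heis_box.
  by rewrite heis_lebesgue_box// ltry.
apply/esym; rewrite -subTset => q _.
pose S := \sum_(i < n) (`|hx q i| + `|hy q i|) + `|q.2 : R|.
have Sk : S < (Num.truncn S).+1%:R by exact: truncnS_gt.
have le_term i : `|hx q i| + `|hy q i| <= S.
  apply: (@le_trans _ _ (\sum_(j < n) (`|hx q j| + `|hy q j|))).
    by rewrite (bigD1 i)//= lerDl sumr_ge0// => j _; rewrite addr_ge0.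
  by rewrite /S lerDl.
exists (Num.truncn S) => //; split => [i|i|].
- rewrite [hx 0 i]mxE subr0; apply: le_lt_trans Sk; apply: le_trans (le_term i).
  by rewrite lerDl.
- rewrite [hy 0 i]mxE subr0; apply: le_lt_trans Sk; apply: le_trans (le_term i).
  by rewrite lerDr.
- rewrite subr0; apply: le_lt_trans Sk; rewrite /S lerDr.
  by apply: sumr_ge0 => i _; rewrite addr_ge0.
Qed.

HB.instance Definition _ := Measure_isSigmaFinite.Build _ (heis R n) R
  (@heis_lebesgue R n) heis_lebesgue_sigma_finite.

End heis_box.

(** * Absolute continuity and derivatives under affine maps and changes of time *)

Section affine_curves.
Context {R : realType}.

Lemma abs_continuous_comp_lipschitz (V W : normedModType R) (f : V -> W)
    (K a b : R) (gamma : R -> V) :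
  (forall p q, `|f p - f q| <= K * `|p - q|) ->
  abs_continuous a b gamma -> abs_continuous a b (f \o gamma).
Proof.
move=> fK ac e e0; pose M := Num.max K 1.
have M0 : 0 < M by rewrite lt_max ltr01 orbT.
have [d d0 H] := ac (e / M) (divr_gt0 e0 M0); exists d => // m u v uv tI sd.
have := H m u v uv tI sd; rewrite ltr_pdivlMr// mulrC; apply: le_lt_trans.
rewrite mulr_sumr; apply: ler_sum => k _ /=; apply: le_trans (fK _ _) _.
by rewrite ler_wpM2r// le_max lexx.
Qed.

(** The bounded linear part L turns the first-order error of [gamma] into that of [f \o gamma].
    Serves translations and dilations as well as the coordinate functionals. *)
Lemma is_derive_comp_affine (V W : normedModType R) (f L : V -> W) (K : R)
    (gamma : R -> V) (s : R) (v : V) :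
  (forall p q, f p - f q = L (p - q)) ->
  (forall p q, L (p - q) = L p - L q) -> (forall c p, L (c *: p) = c *: L p) ->
  (forall p, `|L p| <= K * `|p|) ->
  is_derive s 1 gamma v -> is_derive s 1 (f \o gamma) (L v).
Proof.
move=> fL LB LZ LK /is_derive1P H; apply/is_derive1P => e e0.
pose M := Num.max K 1.
have M0 : 0 < M by rewrite lt_max ltr01 orbT.
have [d d0 {}H] := H _ (divr_gt0 e0 M0); exists d => // x /H.
move=> xs; rewrite /= fL -LZ -LB; apply: le_trans (LK _) _.
apply: (@le_trans _ _ (M * `|gamma x - gamma s - (x - s) *: v|)).
  by rewrite ler_wpM2r// le_max lexx.
apply: le_trans (ler_wpM2l (ltW M0) xs) _.
by rewrite mulrA [M * _]mulrC divfK ?gt_eqF.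
Qed.

Lemma is_derive_reparam (V : normedModType R) (gamma : R -> V) (al be s : R)
    (v : V) : al != 0 ->
  is_derive (al * s + be) 1 gamma v ->
  is_derive s 1 (fun x => gamma (al * x + be)) (al *: v).
Proof.
move=> al0 /is_derive1P H; apply/is_derive1P => e e0.
have na0 : 0 < `|al| by rewrite normr_gt0.
have [d d0 {}H] := H _ (divr_gt0 e0 na0); exists (d / `|al|).
  by rewrite divr_gt0.
have E x : al * x + be - (al * s + be) = al * (x - s) by ring.
move=> x; rewrite ltr_pdivlMr// => xs.
have := H (al * x + be); rewrite E normrM [X in X < d]mulrC => /(_ xs).
by rewrite mulrA divfK ?gt_eqF// scalerA [(x - s) * al]mulrC.
Qed.

(** A nondecreasing map sends disjoint open intervals to intervals with disjoint interiors, and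
    lengths grow by at most K. Constancy on part of [0, 1] is permitted, as concatenation
    requires. *)
Lemma abs_continuous_comp_nondecreasing (V : normedModType R) (gamma : R -> V)
    (phi : R -> R) (K : R) : 0 < K ->
  (forall x, 0 <= x <= 1 -> 0 <= phi x <= 1) ->
  {homo phi : x y / x <= y} ->
  (forall x y, x <= y -> phi y - phi x <= K * (y - x)) ->
  abs_continuous 0 1 gamma -> abs_continuous 0 1 (gamma \o phi).
Proof.
move=> K0 phi01 mono lip ac e e0; have [d d0 H] := ac e e0.
exists (d / K); first by rewrite divr_gt0.
move=> m u v uv tI sd; apply: (H m (phi \o u) (phi \o v)).
- move=> k /=; have [uk uvk vk] := uv k; split.
  + by have /andP[] := phi01 (u k) (introT andP (conj uk (le_trans uvk vk))).
  + exact: mono.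
  + by have /andP[] := phi01 (v k) (introT andP (conj (le_trans uk uvk) vk)).
(* If the interval that starts first ended after [u j], the midpoint of [u j] and the smaller right
   end would lie in both intervals. *)
- have disj (i j : 'I_m) x : u i < v i -> u j < v j -> u i <= u j -> i != j ->
      phi (u i) < x < phi (v i) -> phi (u j) < x -> False.
    move=> ui uj uij ij /andP[_ xi] xj.
    have [vu|uv'] := leP (v i) (u j).
      by have := lt_trans (le_lt_trans (mono _ _ vu) xj) xi; rewrite ltxx.
    move/trivIsetP : tI => /(_ i j I I ij); rewrite -subset0.
    move=> /(_ ((u j + Num.min (v i) (v j)) / 2)); apply; split; rewrite /= in_itv/=.
      have := ge_min (v i) (v i) (v j); rewrite lexx/= => ?.
      have : u j < Num.min (v i) (v j) by rewrite lt_min uv'.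
      by move=> ?; apply/andP; split; lra.
    have := ge_min (v j) (v i) (v j); rewrite lexx/= orbT => ?.
    have : u j < Num.min (v i) (v j) by rewrite lt_min uv'.
    by move=> ?; apply/andP; split; lra.
  have ne k x : phi (u k) < x < phi (v k) -> u k < v k.
    move=> /andP[a b]; have [_ uvk _] := uv k; rewrite lt_neqAle uvk andbT.
    by apply/eqP => E; have := lt_trans a b; rewrite E ltxx.
  apply/trivIsetP => i j _ _ ij; rewrite -subset0 => x [/=].
  rewrite !in_itv/= => xi xj.
  have [uij|uji] := leP (u i) (u j).
    by apply: (disj i j x (ne _ _ xi) (ne _ _ xj) uij ij xi); case/andP: xj.
  apply: (disj j i x (ne _ _ xj) (ne _ _ xi) (ltW uji) _ xj); case/andP: xi => //.
  by rewrite eq_sym.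
- move: sd; rewrite ltr_pdivlMr// mulrC mulr_sumr; apply: le_lt_trans.
  by apply: ler_sum => k _ /=; apply: lip; have [] := uv k.
Qed.

Lemma abs_continuous_reverse (V : normedModType R) (gamma : R -> V) :
  abs_continuous 0 1 gamma -> abs_continuous 0 1 (fun s => gamma (1 - s)).
Proof.
move=> ac e e0; have [d d0 H] := ac e e0; exists d => // m u v uv tI sd.
under eq_bigr do rewrite distrC.
apply: (H m (fun k => 1 - v k) (fun k => 1 - u k)).
- by move=> k; have [? ? ?] := uv k; split; lra.
- apply/trivIsetP => i j _ _ ij; rewrite -subset0 => x [/=].
  rewrite !in_itv/= => /andP[? ?] /andP[? ?].
  move/trivIsetP : tI => /(_ i j I I ij); rewrite -subset0 => /(_ (1 - x)); apply.
  by split; rewrite /= in_itv/=; apply/andP; split; lra.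
- apply: le_lt_trans sd; apply: ler_sum => k _; lra.
Qed.

Lemma abs_continuousD (V : normedModType R) (f g : R -> V) (a b : R) :
  abs_continuous a b f -> abs_continuous a b g ->
  abs_continuous a b (fun s => f s + g s).
Proof.
move=> acf acg e e0; have e20 : 0 < e / 2 by rewrite divr_gt0.
have [d d0 Hf] := acf _ e20; have [d' d'0 Hg] := acg _ e20.
exists (Num.min d d'); first by rewrite lt_min d0.
move=> m u v uv tI; rewrite lt_min => /andP[/(Hf m u v uv tI) sf /(Hg m u v uv tI) sg].
rewrite (splitr e); apply: le_lt_trans (ltrD sf sg).
rewrite -big_split/=; apply: ler_sum => k _.
by rewrite opprD addrACA ler_normD.
Qed.

Lemma abs_continuous_cst (V : normedModType R) (c : V) (a b : R) :
  abs_continuous a b (fun=> c).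
Proof.
move=> e e0; exists 1 => // m u v _ _ _.
by rewrite big1// => k _; rewrite subrr normr0.
Qed.

Lemma abs_continuous_id (a b : R) : abs_continuous a b (id : R -> R).
Proof.
move=> e e0; exists e => // m u v uv _; apply: le_lt_trans.
by apply: ler_sum => k _; have [_ ? _] := uv k; rewrite ger0_norm// subr_ge0.
Qed.

End affine_curves.

(** * The Carnot-Caratheodory distance *)

Section horizontal_curves.
Context {R : realType} {n : nat}.
Implicit Types p v : heis R n.

Lemma heis_normP v (M : R) : 0 <= M ->
  `|v| <= M <-> [/\ forall i, `|hx v i| <= M, forall i, `|hy v i| <= M &
                    `|v.2 : R| <= M].
Proof.
move=> M0.
have rV (w : 'rV[R]_n) : `|w| <= M <-> forall i, `|w ord0 i| <= M.
  rewrite -[`|w|]/(mx_norm w); split=> [wM i|H].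
    apply: le_trans wM; rewrite mx_normrE; exact: (le_bigmax _ _ (ord0, i)).
  rewrite mx_normrE; apply/bigmax_leP; split => // -[i j] _ /=.
  by rewrite ord1.
rewrite !prod_normE /= !ge_max; split.
  by move=> /andP[/andP[/rV ? /rV ?] ?]; split.
by move=> [/rV -> /rV -> ->].
Qed.

Definition speed (a b : 'I_n -> R -> R) (s : R) : R :=
  Num.sqrt (\sum_(i < n) (a i s ^+ 2 + b i s ^+ 2)).

Lemma measurable_speed (D : set R) a b :
  (forall i, measurable_fun D (a i)) -> (forall i, measurable_fun D (b i)) ->
  measurable_fun D (speed a b).
Proof.
move=> ma mb.
have ms : measurable_fun setT (@Num.sqrt R).
  by apply: continuous_measurable_fun; exact: sqrt_continuous.
apply: (measurableT_comp ms); apply: measurable_sum => i.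
by apply: measurable_funD; exact: measurable_funX.
Qed.

Lemma speed_scale a b (c s : R) :
  speed (fun i x => c * a i x) (fun i x => c * b i x) s = `|c| * speed a b s.
Proof.
rewrite /speed -sqrtr_sqr -sqrtrM ?sqr_ge0// mulr_sumr; congr Num.sqrt.
by apply: eq_bigr => i _; rewrite !exprMn mulrDr.
Qed.

Lemma cc_dist_le_length (gamma : R -> heis R n) a b :
  horizontal gamma a b ->
  (cc_dist (gamma 0%R) (gamma 1%R) <= horizontal_length a b)%E.
Proof. by move=> h; apply: ereal_inf_lbound; exists gamma, a, b. Qed.

Lemma le_cc_dist (p q : heis R n) (M : \bar R) :
  (forall gamma a b, horizontal gamma a b -> gamma 0 = p -> gamma 1 = q ->
    (M <= horizontal_length a b)%E) -> (M <= cc_dist p q)%E.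
Proof.
by move=> H; apply: le_ereal_inf_tmp => _ [gamma [a [b [h g0 g1 ->]]]]; exact: H h g0 g1.
Qed.

(** Since L maps the frame at p to c times the frame at [f p], the image under f of a horizontal
    curve is horizontal with all controls multiplied by c, and its length is multiplied by c. *)
Lemma cc_dist_map (f L : heis R n -> heis R n) (c K : R) (p q : heis R n) : 0 < c ->
  (forall p q, f p - f q = L (p - q)) ->
  (forall p q, L (p - q) = L p - L q) -> (forall c p, L (c *: p) = c *: L p) ->
  (forall p, `|L p| <= K * `|p|) ->
  (forall i p, L (hX i p) = c *: hX i (f p)) ->
  (forall i p, L (hY i p) = c *: hY i (f p)) ->
  (cc_dist (f p) (f q) <= c%:E * cc_dist p q)%E.
Proof.
move=> c0 fL LB LZ LK LX LY.
rewrite -lee_pdivrMl//; apply: le_cc_dist => gamma a b [ac ma mb dg] <- <-.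
rewrite lee_pdivrMl//.
have L0 : L 0 = 0 by rewrite -(subrr 0) LB !subrr.
have LD u v : L (u + v) = L u + L v.
  have LN w : L (- w) = - L w by rewrite -sub0r LB L0 sub0r.
  by rewrite -[v in LHS]opprK LB LN opprK.
have Lsum (F : 'I_n -> heis R n) : L (\sum_(i < n) F i) = \sum_(i < n) L (F i).
  by apply: (big_morph L LD L0).
pose a' i x := c * a i x; pose b' i x := c * b i x.
have hor : horizontal (f \o gamma) a' b'.
  split.
  - by apply: abs_continuous_comp_lipschitz ac => u v; rewrite fL; exact: LK.
  - by move=> i; apply: measurable_funM.
  - by move=> i; apply: measurable_funM.
  - have ? := ae_filter_ringOfSetsType (@lebesgue_measure R).
    apply: filterS dg => s /[apply] dg.
    have := is_derive_comp_affine fL LB LZ LK dg.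
    rewrite Lsum; congr is_derive; apply: eq_bigr => i _.
    by rewrite LD !LZ LX LY !scalerA /a' /b' [c * a i s]mulrC [c * b i s]mulrC.
apply: le_trans (cc_dist_le_length hor) _.
rewrite /horizontal_length -ge0_integralZl//=; first last.
- exact: ltW.
- by apply/measurable_EFinP; exact: measurable_speed.
rewrite le_eqVlt; apply/orP; left; apply/eqP.
by apply: eq_integral => s _; rewrite -EFinM -[in RHS](gtr0_norm c0) -speed_scale.
Qed.

End horizontal_curves.

(** * Reversal and concatenation: symmetry and triangle inequality *)

Section reparametrization.
Context {R : realType} {n : nat}.
Implicit Types (a b : 'I_n -> R -> R).
Notation mu := (@lebesgue_measure R).

(** The factor [|al|] of the speed cancels the Jacobian. Only an inequality results, because D may
    be smaller than the full preimage of [0, 1]. *)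
Lemma length_reparam (D : set R) (al be : R) a b a' b' :
  al != 0 -> measurable D -> (forall s, D s -> 0 <= al * s + be <= 1) ->
  (forall i, measurable_fun (`[0, 1] : set R) (a i)) ->
  (forall i, measurable_fun (`[0, 1] : set R) (b i)) ->
  (forall s, D s -> speed a' b' s = `|al| * speed a b (al * s + be)) ->
  (\int[mu]_(s in D) (speed a' b' s)%:E <= horizontal_length a b)%E.
Proof.
move=> al0 mD D01 ma mb sp.
pose phi (s : measurableTypeR R) : measurableTypeR R := al * (s : R) + be.
pose H := (EFin \o speed a b) \_ (`[0, 1]%classic : set (measurableTypeR R)).
have mH : measurable_fun setT H.
  apply/(measurable_restrictT _ _).1 => //.
  by apply/measurable_EFinP; exact: measurable_speed.
have H0 x : (0 <= H x)%E.
  by apply: erestrict_ge0 => y _; rewrite lee_fin sqrtr_ge0.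
have sc := lebesgue_affine be al0; have [_ mphi _] := sc.
rewrite (@eq_integral _ _ _ _ _
    (fun s => `|al|%:E * H (phi s))%E).
  apply: (@le_trans _ _ (\int[mu]_s (`|al|%:E * H (phi s)))%E).
    apply: ge0_subset_integral => //=.
    - apply: emeasurable_funM => //; exact: (measurableT_comp mH mphi).
    - by move=> x _; rewrite mule_ge0.
  rewrite ge0_integralZl//; last exact: (measurableT_comp mH mphi).
  rewrite (scales_integral sc)// muleA -EFinM mulfV ?normr_eq0// mul1e.
  by rewrite /horizontal_length [leRHS]integral_mkcond; exact: lexx.
move=> s /[!inE] Ds; rewrite sp// /H patchE mem_set ?EFinM//=.
by rewrite in_itv/= D01.
Qed.

Lemma cc_dist_sym_le (p q : heis R n) : (cc_dist q p <= cc_dist p q)%E.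
Proof.
apply: le_cc_dist => gamma a b [ac ma mb dg] <- <-.
(* Written in the form [al * s + be] of the reparametrization lemmas; reversing time changes the
   sign of the controls. *)
pose rev (s : R) := -1 * s + 1.
pose a' i s := - a i (rev s); pose b' i s := - b i (rev s).
have N1 : -1 != 0 :> R by rewrite oppr_eq0 oner_eq0.
have rev01 s : s \in `[0, 1] -> rev s \in `[0, 1].
  by rewrite !in_itv/= /rev => /andP[? ?]; apply/andP; split; lra.
have mrev (f : R -> R) : measurable_fun (`[0, 1] : set R) f ->
    measurable_fun (`[0, 1] : set R) (fun s => - f (rev s)).
  move=> mf; apply: measurableT_comp => //.
  apply: (@measurable_comp _ _ _ _ _ _ (`[0, 1]%classic : set R)) => //.
    by move=> _ [s /= s01 <-]; exact: rev01.
  by apply: measurable_funD => //; apply: measurable_funM.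
have hor : horizontal (gamma \o rev) a' b'.
  split; [|by move=> i; exact: mrev|by move=> i; exact: mrev|].
    rewrite (_ : gamma \o rev = fun s => gamma (1 - s)).
      exact: abs_continuous_reverse.
    by apply/funext => s /=; rewrite /rev mulN1r addrC.
  have ? := ae_filter_ringOfSetsType mu.
  have : {ae mu, forall s : R, rev s \in `[0, 1] -> is_derive (rev s) 1 gamma
      (\sum_(i < n) (a i (rev s) *: hX i (gamma (rev s)) +
        b i (rev s) *: hY i (gamma (rev s))))}.
    exact: (scales_negligible (lebesgue_affine 1 N1) dg).
  apply: filterS => s H /rev01 /H {}H.
  have := is_derive_reparam N1 H; congr is_derive.
  rewrite scaler_sumr; apply: eq_bigr => i _.
  by rewrite /a' /b' scaleN1r opprD !scaleNr.
have -> : gamma 1 = (gamma \o rev) 0 by rewrite /= /rev mulr0 add0r.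
have -> : gamma 0 = (gamma \o rev) 1 by rewrite /= /rev mulr1 addNr.
apply: le_trans (cc_dist_le_length hor) _.
apply: (length_reparam (al := -1) (be := 1)) => //.
move=> s _; rewrite normrN1 mul1r /speed; congr Num.sqrt.
by apply: eq_bigr => i _; rewrite /a' /b' !sqrrN.
Qed.

Lemma cc_dist_sym (p q : heis R n) : cc_dist p q = cc_dist q p.
Proof. by apply/eqP; rewrite eq_le !cc_dist_sym_le. Qed.

Lemma cc_dist_concat (g1 g2 : R -> heis R n) a1 b1 a2 b2 :
  horizontal g1 a1 b1 -> horizontal g2 a2 b2 -> g1 1 = g2 0 ->
  (cc_dist (g1 0%R) (g2 1%R) <= horizontal_length a1 b1 + horizontal_length a2 b2)%E.
Proof.
move=> [ac1 ma1 mb1 dg1] [ac2 ma2 mb2 dg2] g12.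
(* Gluing by [min] and [max] writes the concatenation as a sum of reparametrized
   curves, so that no interval has to be split at 1/2 for absolute continuity. *)
pose phi1 (s : R) := 2 * Num.min s 2^-1; pose phi2 (s : R) := 2 * Num.max s 2^-1 - 1.
pose g s : heis R n := g1 (phi1 s) + (g2 (phi2 s) - g2 0).
(* Each curve is run in half the time, hence the doubled controls. The summand [+ 0] keeps the form
   [al * s + be]. *)
pose join (f1 f2 : R -> R) s :=
  if s <= 2^-1 then 2 * f1 (2 * s + 0) else 2 * f2 (2 * s + - 1).
pose a i := join (a1 i) (a2 i); pose b i := join (b1 i) (b2 i).
pose vel (g0 : R -> heis R n) (a0 b0 : 'I_n -> R -> R) i s :=
  a0 i s *: hX i (g0 s) + b0 i s *: hY i (g0 s).
have N2 : 2 != 0 :> R by rewrite pnatr_eq0.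
have H2 : 2 * 2^-1 = 1 :> R by rewrite mulfV.
have gl s : s <= 2^-1 -> g s = g1 (2 * s + 0).
  by move=> sl; rewrite /g /phi1 /phi2 min_l// max_r// H2 subrr addr0 subrr addr0.
have gr s : 2^-1 <= s -> g s = g2 (2 * s + - 1).
  by move=> sr; rewrite /g /phi1 /phi2 min_r// max_l// H2 g12 addrC subrK.
pose D1 : set R := `[0, 2^-1]%classic; pose D2 : set R := `]2^-1, 1]%classic.
have D1P s : D1 s -> 0 <= 2 * s + 0 <= 1.
  by rewrite /D1 /= in_itv/= => /andP[? ?]; apply/andP; split; lra.
have D2P s : D2 s -> 0 <= 2 * s + - 1 <= 1.
  by rewrite /D2 /= in_itv/= => /andP[? ?]; apply/andP; split; lra.
have DU : `[0, 1]%classic = D1 `|` D2.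
  apply/seteqP; split => s; rewrite /D1 /D2 /= !in_itv/=.
    by move=> /andP[s0 s1]; case: (leP s 2^-1) => ?; [left|right]; rewrite ?s0.
  by case=> /andP[? ?]; apply/andP; split; lra.
have mD1 : measurable D1 by exact: measurable_itv.
have mD2 : measurable D2 by exact: measurable_itv.
have mpull (f : R -> R) (D : set R) be : measurable D ->
    (forall s, D s -> 0 <= 2 * s + be <= 1) ->
    measurable_fun (`[0, 1] : set R) f -> measurable_fun D (fun s => 2 * f (2 * s + be)).
  move=> mD DP mf; apply: measurable_funM => //.
  apply: (@measurable_comp _ _ _ _ _ _ (`[0, 1]%classic : set R)) => //.
    by move=> _ [s /= Ds <-]; rewrite in_itv/=; exact: DP.
  by apply: measurable_funD => //; apply: measurable_funM.
have joinl f1 f2 s : D1 s -> join f1 f2 s = 2 * f1 (2 * s + 0).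
  by rewrite /D1 /join /= in_itv/= => /andP[_ ->].
have joinr f1 f2 s : D2 s -> join f1 f2 s = 2 * f2 (2 * s + - 1).
  by rewrite /D2 /join /= in_itv/= => /andP[]; rewrite ltNge => /negPf ->.
have mjoin (f1 f2 : R -> R) : measurable_fun (`[0, 1] : set R) f1 ->
    measurable_fun (`[0, 1] : set R) f2 -> measurable_fun (`[0, 1] : set R) (join f1 f2).
  move=> mf1 mf2; rewrite DU; apply/measurable_funU => //; split.
    apply: eq_measurable_fun (mpull _ _ _ mD1 D1P mf1) => s.
    by rewrite inE => Ds; rewrite joinl.
  apply: eq_measurable_fun (mpull _ _ _ mD2 D2P mf2) => s.
  by rewrite inE => Ds; rewrite joinr.
have hor : horizontal g a b.
  split; [|by move=> i; exact: mjoin|by move=> i; exact: mjoin|].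
    apply: abs_continuousD.
      apply: (@abs_continuous_comp_nondecreasing _ _ g1 phi1 2) => //.
      - move=> x /andP[x0 x1]; rewrite /phi1.
        have [xl|xr] := leP x 2^-1; rewrite ?H2 ?lexx ?ler01//.
        by apply/andP; split; lra.
      - by move=> x y xy; rewrite /phi1 ler_wpM2l// le_min !ge_min xy lexx orbT.
      - move=> x y xy; rewrite /phi1 -mulrBr ler_wpM2l//.
        by case: (leP x 2^-1); case: (leP y 2^-1); lra.
    apply: abs_continuousD; last exact: abs_continuous_cst.
    apply: (@abs_continuous_comp_nondecreasing _ _ g2 phi2 2) => //.
    - move=> x /andP[x0 x1]; rewrite /phi2.
      have [xl|xr] := leP x 2^-1; rewrite ?H2 ?subrr ?lexx ?ler01//.
      by apply/andP; split; lra.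
    - by move=> x y xy; rewrite /phi2 lerD2r ler_wpM2l// ge_max !le_max xy lexx orbT.
    - move=> x y xy; rewrite /phi2.
      by case: (leP x 2^-1); case: (leP y 2^-1); lra.
  have ? := ae_filter_ringOfSetsType mu.
  have ae1 := scales_negligible (lebesgue_affine 0 N2) dg1.
  have ae2 := scales_negligible (lebesgue_affine (- 1) N2) dg2.
  (* At the junction the one-sided velocities may disagree; this single time is discarded as a null
     set. *)
  have ae3 : mu.-negligible [set (2^-1 : R)].
    by exists [set 2^-1]; split => //; exact: lebesgue_measure_set1.
  have {}ae1 : {ae mu, forall s : R, 2 * s + 0 \in `[0, 1] ->
      is_derive (2 * s + 0) 1 g1 (\sum_(i < n) vel g1 a1 b1 i (2 * s + 0))}.
    exact: ae1.
  have {}ae2 : {ae mu, forall s : R, 2 * s + - 1 \in `[0, 1] ->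
      is_derive (2 * s + - 1) 1 g2 (\sum_(i < n) vel g2 a2 b2 i (2 * s + - 1))}.
    exact: ae2.
  have {}ae3 : {ae mu, forall s : R, s != 2^-1}.
    by apply: negligibleS ae3 => s /= /negP; rewrite negbK => /eqP.
  apply: filterS3 ae1 ae2 ae3 => s d1 d2 s2 s01.
  have [sl|sr] := leP s 2^-1.
    have Ds : D1 s by move: s01; rewrite /D1 /= !in_itv/= sl => /andP[-> _].
    have {}sl : s < 2^-1 by rewrite lt_neqAle s2.
    have := d1; rewrite in_itv/= (D1P _ Ds) => /(_ isT) /(is_derive_reparam N2) d.
    have := near_eq_is_derive _ d (g := g).
    rewrite gl ?ltW// scaler_sumr => dd.
    rewrite (eq_bigr (fun i => 2 *: vel g1 a1 b1 i (2 * s + 0))).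
      apply: dd; near=> x; rewrite gl//; near: x.
      by apply: (cvgr_le s) sl; exact: cvg_id.
    by move=> i _; rewrite /a /b /vel !joinl// scalerDr !scalerA.
  have Ds : D2 s by move: s01; rewrite /D2 /= !in_itv/= sr => /andP[_ ->].
  have := d2; rewrite in_itv/= (D2P _ Ds) => /(_ isT) /(is_derive_reparam N2) d.
  have := near_eq_is_derive _ d (g := g).
  rewrite gr ?ltW// scaler_sumr => dd.
  rewrite (eq_bigr (fun i => 2 *: vel g2 a2 b2 i (2 * s + - 1))).
    apply: dd; near=> x; rewrite gr//; near: x.
    by apply: (cvgr_ge s) sr; exact: cvg_id.
  by move=> i _; rewrite /a /b /vel !joinr// scalerDr !scalerA.
have -> : g1 0 = g 0 by rewrite gl ?invr_ge0// mulr0 addr0.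
have -> : g2 1 = g 1.
  by rewrite gr ?invf_le1 ?ler1n//; congr g2; lra.
apply: le_trans (cc_dist_le_length hor) _.
have -> : horizontal_length a b = (\int[mu]_(s in D1) (speed a b s)%:E
    + \int[mu]_(s in D2) (speed a b s)%:E)%E.
  rewrite /horizontal_length [X in integral _ X](_ : _ = D1 `|` D2); last first.
    by rewrite -DU.
  rewrite ge0_integral_setU//.
  - rewrite -DU; apply/measurable_EFinP; apply: measurable_speed => i; exact: mjoin.
  - apply/disj_setPS => s []; rewrite /D1 /D2 /= !in_itv/= => /andP[_ sl] /andP[sr _].
    by have := lt_le_trans sr sl; rewrite ltxx.
have sj f1 f2 f3 f4 s (c : R) be : (forall i, f3 i s = 2 * f1 i (2 * s + be)) ->
    (forall i, f4 i s = 2 * f2 i (2 * s + be)) ->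
    speed f3 f4 s = `|2 : R| * speed f1 f2 (2 * s + be).
  move=> E1 E2; rewrite -speed_scale /speed; congr Num.sqrt.
  by apply: eq_bigr => i _; rewrite E1 E2.
apply: leeD.
- apply: (length_reparam (al := 2) (be := 0)) => // s Ds.
  by apply: sj => // i; rewrite /a /b joinl.
- apply: (length_reparam (al := 2) (be := - 1)) => // s Ds.
  by apply: sj => // i; rewrite /a /b joinr.
Unshelve. all: by end_near. Qed.

Lemma cc_dist_ge0 (p q : heis R n) : (0 <= cc_dist p q)%E.
Proof.
apply: le_cc_dist => gamma a b _ _ _.
by apply: integral_ge0 => s _; rewrite lee_fin sqrtr_ge0.
Qed.

Lemma cc_dist_triangle (q p w : heis R n) :
  (cc_dist p w <= cc_dist p q + cc_dist q w)%E.
Proof.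
(* Nearly minimal curves exist only at finite distance; otherwise the right-hand side is +oo. *)
have [pq|] := boolP (cc_dist p q \is a fin_num); last first.
  rewrite ge0_fin_numE ?cc_dist_ge0// -leNgt leye_eq => /eqP ->.
  by rewrite addye ?leey// gt_eqF// (lt_le_trans _ (cc_dist_ge0 _ _)).
have [qw|] := boolP (cc_dist q w \is a fin_num); last first.
  rewrite ge0_fin_numE ?cc_dist_ge0// -leNgt leye_eq => /eqP ->.
  by rewrite addey ?leey// gt_eqF// (lt_le_trans _ (cc_dist_ge0 _ _)).
apply/lee_addgt0Pr => e e0; have e20 : 0 < e / 2 by rewrite divr_gt0.
have [_ [g1 [a1 [b1 [h1 <- g11 ->]]]] l1] := lb_ereal_inf_adherent e20 pq.
have [_ [g2 [a2 [b2 [h2 g20 <- ->]]]] l2] := lb_ereal_inf_adherent e20 qw.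
apply: le_trans (cc_dist_concat h1 h2 _) _; first by rewrite g11.
apply: le_trans (leeD (ltW l1) (ltW l2)) _.
by rewrite addeACA -EFinD -splitr.
Qed.

End reparametrization.

(** * Translations and dilations *)

Section heis_group.
Context {R : realType} {n : nat}.
Implicit Types g p q v : heis R n.

Lemma heis_ext p q : p.1.1 = q.1.1 -> p.1.2 = q.1.2 -> (p.2 : R) = q.2 -> p = q.
Proof. by case: p q => [[x y] t] [[x' y'] t'] /= -> -> ->. Qed.

Definition heis_inv g : heis R n := (- g.1.1, - g.1.2, - (g.2 : R) : measurableTypeR R).
(** The standard symplectic form of R^(2n), applied to the horizontal coordinates. *)
Definition symp g v : R := \sum_(i < n) (hx g i * hy v i - hy g i * hx v i).

Lemma hx_mul g p i : hx (heis_mul g p) i = hx g i + hx p i.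
Proof. by rewrite /hx mxE. Qed.

Lemma hy_mul g p i : hy (heis_mul g p) i = hy g i + hy p i.
Proof. by rewrite /hy mxE. Qed.

(** The differential of left translation by g, the same at every point because the translation is
    affine. *)
Definition heis_mul_lin g v : heis R n :=
  (v.1.1, v.1.2, (v.2 : R) + 2^-1 * symp g v : measurableTypeR R).

Lemma sympE g v : symp g v =
  \sum_(i < n) (g.1.1 ord0 i * v.1.2 ord0 i - g.1.2 ord0 i * v.1.1 ord0 i).
Proof. by []. Qed.

Lemma symp_combr g (c : R) p q : symp g (c *: p + q) = c * symp g p + symp g q.
Proof.
rewrite !sympE mulr_sumr -big_split; apply: eq_bigr => i _ /=.
by rewrite !mxE; ring.
Qed.

Lemma sympBr g p q : symp g (p - q) = symp g p - symp g q.
Proof. by rewrite addrC -scaleN1r symp_combr mulN1r addrC. Qed.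

Lemma sympZr g c p : symp g (c *: p) = c * symp g p.
Proof.
rewrite !sympE mulr_sumr; apply: eq_bigr => i _ /=.
by rewrite !mxE; ring.
Qed.

Lemma heis_mulB g p q : heis_mul g p - heis_mul g q = heis_mul_lin g (p - q).
Proof.
apply: heis_ext => /=.
- by rewrite opprD addrACA subrr add0r.
- by rewrite opprD addrACA subrr add0r.
- rewrite sympBr.
  change ((g.2 : R) + (p.2 : R) + 2^-1 * symp g p -
      ((g.2 : R) + (q.2 : R) + 2^-1 * symp g q) =
    ((p.2 : R) - (q.2 : R)) + 2^-1 * (symp g p - symp g q)).
  by move: (symp _ _) (symp _ _) (g.2 : R) (p.2 : R) (q.2 : R) => ? ? ? ? ?; ring.
Qed.

Lemma symp_hX g i p : symp g (hX i p) = - hy g i.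
Proof.
rewrite sympE (bigD1 i)//= big1 => [|j ji];
  rewrite !mxE ?eqxx ?(negPf ji) /= ?mulr0 ?subrr//.
by rewrite mulr1 sub0r addr0.
Qed.

Lemma symp_hY g i p : symp g (hY i p) = hx g i.
Proof.
rewrite sympE (bigD1 i)//= big1 => [|j ji];
  rewrite !mxE ?eqxx ?(negPf ji) /= ?mulr0 ?subrr//.
by rewrite mulr1 subr0 addr0.
Qed.

Lemma heis_norm_coord v :
  [/\ forall i, `|hx v i| <= `|v|, forall i, `|hy v i| <= `|v| & `|v.2 : R| <= `|v|].
Proof. exact/(heis_normP _ (normr_ge0 v)). Qed.

Lemma symp_bound g v :
  `|symp g v| <= (\sum_(i < n) (`|hx g i| + `|hy g i|)) * `|v|.
Proof.
have [vx vy _] := heis_norm_coord v.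
rewrite mulr_suml; apply: le_trans (ler_norm_sum _ _ _) _; apply: ler_sum => i _.
apply: le_trans (ler_normB _ _) _; rewrite !normrM mulrDl.
by apply: lerD; rewrite ler_wpM2l.
Qed.

Lemma cc_dist_mul_le g p q :
  (cc_dist (heis_mul g p) (heis_mul g q) <= cc_dist p q)%E.
Proof.
pose S := \sum_(i < n) (`|hx g i| + `|hy g i|).
have S0 : 0 <= S by apply: sumr_ge0 => i _; rewrite addr_ge0.
rewrite -[leRHS]mul1e.
(* In the maximum norm, 1 + S bounds the differential: the shear adds at most S times the norm to
   the t-coordinate. *)
apply: (@cc_dist_map _ _ _ (heis_mul_lin g) 1 (1 + S)) => //.
- exact: heis_mulB.
- move=> u v; apply: heis_ext => //=; rewrite sympBr mulrBr.
  by rewrite opprD addrACA.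
- move=> c v; apply: heis_ext => //=; rewrite sympZr mulrCA -mulrDr.
  by [].
- move=> v; have [vx vy vt] := heis_norm_coord v.
  apply/heis_normP; first by rewrite mulr_ge0// addr_ge0.
  have le1 (x : R) : x <= `|v| -> x <= (1 + S) * `|v|.
    by move=> /le_trans; apply; rewrite mulrDl mul1r lerDl mulr_ge0.
  split => [i|i|]; [exact: (le1 _ (vx i))|exact: (le1 _ (vy i))|].
  rewrite mulrDl mul1r; apply: le_trans (ler_normD _ _) _; apply: lerD => //.
  rewrite normrM ger0_norm ?invr_ge0//; apply: le_trans (symp_bound g v).
  by rewrite ler_piMl// invf_le1// ler1n.
- move=> i p'; apply: heis_ext; rewrite ?scale1r//.
  change (- (hy p' i / 2) + 2^-1 * symp g (hX i p') = - (hy (heis_mul g p') i / 2)).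
  by rewrite symp_hX hy_mul; ring.
- move=> i p'; apply: heis_ext; rewrite ?scale1r//.
  change (hx p' i / 2 + 2^-1 * symp g (hY i p') = hx (heis_mul g p') i / 2).
  by rewrite symp_hY hx_mul; ring.
Qed.

Lemma symp_diag g : symp g g = 0.
Proof. by rewrite sympE big1// => i _; rewrite mulrC subrr. Qed.

Lemma heis_mulKg g p : heis_mul (heis_inv g) (heis_mul g p) = p.
Proof.
apply: heis_ext => /=; [by rewrite addKr|by rewrite addKr|].
rewrite -/(symp (heis_inv g) (heis_mul g p)).
have -> : symp (heis_inv g) (heis_mul g p) = - symp g p.
  rewrite -[RHS](add0r _) -oppr0 -(symp_diag g) -opprD !sympE -big_split/= -sumrN.
  by apply: eq_bigr => i _; rewrite !mxE; ring.
change (- (g.2 : R) + ((g.2 : R) + (p.2 : R) + 2^-1 * symp g p) +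
  2^-1 * - symp g p = p.2).
by move: (symp _ _) (g.2 : R) (p.2 : R) => ? ? ?; ring.
Qed.

Lemma cc_dist_mul g p q : cc_dist (heis_mul g p) (heis_mul g q) = cc_dist p q.
Proof.
apply/eqP; rewrite eq_le cc_dist_mul_le/=.
by rewrite -[in leLHS](heis_mulKg g p) -[in leLHS](heis_mulKg g q) cc_dist_mul_le.
Qed.

(** The square on t is what makes the linear part send X_i at p to l times X_i at the dilated point:
    the t-component of X_i is itself linear in y. *)
Definition heis_dil (l : R) p : heis R n :=
  (l *: p.1.1, l *: p.1.2, l ^+ 2 * (p.2 : R) : measurableTypeR R).

Lemma cc_dist_dil_le (l : R) p q : 0 < l ->
  (cc_dist (heis_dil l p) (heis_dil l q) <= l%:E * cc_dist p q)%E.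
Proof.
move=> l0; apply: (@cc_dist_map _ _ _ (heis_dil l) l (l + l ^+ 2)) => //.
- by move=> u v; apply: heis_ext; rewrite /= ?scalerBr ?mulrBr.
- by move=> u v; apply: heis_ext; rewrite /= ?scalerBr ?mulrBr.
- move=> c v; apply: heis_ext.
  + by rewrite /= !scalerA mulrC.
  + by rewrite /= !scalerA mulrC.
  + change (l ^+ 2 * (c * (v.2 : R)) = c * (l ^+ 2 * (v.2 : R))).
    by rewrite mulrCA.
- move=> v; have [vx vy vt] := heis_norm_coord v.
  have l20 : 0 <= l ^+ 2 by rewrite sqr_ge0.
  apply/heis_normP; first by rewrite mulr_ge0// addr_ge0// ltW.
  split => [i|i|]; rewrite /hx /hy /= ?mxE normrM.
  + rewrite gtr0_norm//; apply: ler_pM; rewrite ?lerDl ?(ltW l0) ?normr_ge0//.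
    exact: vx.
  + rewrite gtr0_norm//; apply: ler_pM; rewrite ?lerDl ?(ltW l0) ?normr_ge0//.
    exact: vy.
  + by rewrite ger0_norm//; apply: ler_pM; rewrite ?lerDr ?(ltW l0).
- move=> i p'; apply: heis_ext; rewrite /= ?scaler0//.
  change (l ^+ 2 * - (hy p' i / 2) = l * - (hy (heis_dil l p') i / 2)).
  by rewrite /hy /= !mxE; move: (_ ord0 i) => ?; ring.
- move=> i p'; apply: heis_ext; rewrite /= ?scaler0//.
  change (l ^+ 2 * (hx p' i / 2) = l * (hx (heis_dil l p') i / 2)).
  by rewrite /hx /= !mxE; move: (_ ord0 i) => ?; ring.
Qed.

Lemma heis_dilK l p : l != 0 -> heis_dil l^-1 (heis_dil l p) = p.
Proof.
move=> l0; apply: heis_ext; rewrite /= ?scalerA ?mulVf ?scale1r//.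
by rewrite mulrA -exprMn mulVf// expr1n mul1r.
Qed.

Lemma cc_dist_dil (l : R) p q : 0 < l ->
  (cc_dist (heis_dil l p) (heis_dil l q) = l%:E * cc_dist p q)%E.
Proof.
move=> l0; apply/eqP; rewrite eq_le cc_dist_dil_le//=.
rewrite -lee_pdivlMl//.
have l00 : l != 0 by rewrite gt_eqF.
rewrite -[in leLHS](heis_dilK p l00) -[in leLHS](heis_dilK q l00).
by apply: cc_dist_dil_le; rewrite invr_gt0.
Qed.

Lemma cc_ball_mul g p (r : R) :
  heis_mul g @^-1` cc_ball (heis_mul g p) r = cc_ball p r.
Proof. by apply/seteqP; split => q; rewrite /cc_ball /= cc_dist_mul. Qed.

Lemma heis_mulg0 g : heis_mul g 0 = g.
Proof.
apply: heis_ext; rewrite /= ?addr0//.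
have -> : \sum_(i < n) (hx g i * hy (0 : heis R n) i - hy g i * hx (0 : heis R n) i) = 0.
  by rewrite big1// => i _; rewrite /hx /hy !mxE !mulr0 subrr.
by rewrite mulr0 !addr0.
Qed.

Lemma cc_ball_dil (l r : R) : 0 < l ->
  heis_dil l @^-1` cc_ball 0 (l * r) = cc_ball 0 r.
Proof.
move=> l0.
have dil0 : heis_dil l 0 = 0 by apply: heis_ext; rewrite /= ?scaler0 ?mulr0.
have E q : cc_dist 0 (heis_dil l q) = (l%:E * cc_dist 0%R q)%E.
  by rewrite -cc_dist_dil// dil0.
by apply/seteqP; split => q; rewrite /cc_ball /= E EFinM lte_pmul2l.
Qed.

Lemma heis_lebesgue_mul g (A : set (heis R n)) : measurable A ->
  heis_lebesgue (heis_mul g @^-1` A) = heis_lebesgue A.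
Proof.
move=> mA.
(* Over fixed (x, y) the translation moves t by this constant, so it is a shear in the sense of
   [heis_affine]. *)
pose tau (z : 'rV[R]_n * 'rV[R]_n) : R :=
  (g.2 : R) + 2^-1 * \sum_(i < n) (hx g i * z.2 ord0 i - hy g i * z.1 ord0 i).
have mtau : measurable_fun setT (tau : _ -> measurableTypeR R).
  have m1 i : measurable_fun setT
      (fun z : 'rV[R]_n * 'rV[R]_n => z.1 ord0 i : measurableTypeR R).
    exact: (measurableT_comp (measurable_coord i) measurable_fst).
  have m2 i : measurable_fun setT
      (fun z : 'rV[R]_n * 'rV[R]_n => z.2 ord0 i : measurableTypeR R).
    exact: (measurableT_comp (measurable_coord i) measurable_snd).
  apply: measurable_funD => //; apply: measurable_funM => //.
  apply: measurable_sum => i; apply: measurable_funB; apply: measurable_funM => //.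
    exact: m2.
  exact: m1.
have [_ _ H] := heis_affine g.1.1 g.1.2 (oner_neq0 R) (oner_neq0 R) mtau.
rewrite -[RHS]mul1e.
move: (H A mA); set F := (fun _ => _).
have <- : heis_mul g = F.
  apply/funext => p; apply: heis_ext.
  - by rewrite /= scale1r addrC.
  - by rewrite /= scale1r addrC.
  - change ((g.2 : R) + (p.2 : R) + 2^-1 * symp g p =
      1 * (p.2 : R) + ((g.2 : R) + 2^-1 * symp g p)).
    by move: (symp _ _) (g.2 : R) (p.2 : R) => ? ? ?; ring.
by rewrite normr1 invr1 !expr1n !mulr1.
Qed.

(** The exponent is the homogeneous dimension: n for x, n for y and 2 for t. *)
Lemma heis_lebesgue_dil (l : R) (A : set (heis R n)) : 0 < l -> measurable A ->
  heis_lebesgue (heis_dil l @^-1` A) = ((l ^- (n + n + 2))%:E * heis_lebesgue A)%E.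
Proof.
move=> l0 mA.
have l00 : l != 0 by rewrite gt_eqF.
have [_ _ H] := heis_affine (0 : 'rV[R]_n) 0 (tau := fun=> 0) l00
  (expf_neq0 2 l00) (measurable_cst _).
move: (H A mA); set F := (fun _ => _).
have <- : heis_dil l = F.
  by apply/funext => p; apply: heis_ext; rewrite /= ?addr0.
by rewrite normrX gtr0_norm// !exprVn -!invfM -!exprD.
Qed.

End heis_group.

(** * Topology of the balls *)

Section local_bound.
Context {R : realType} {n : nat}.
Implicit Types g p q v : heis R n.

Lemma heis_sum11 (F : 'I_n -> heis R n) : (\sum_(i < n) F i).1.1 = \sum_(i < n) (F i).1.1.
Proof. by apply: (big_morph (fun p : heis R n => p.1.1)). Qed.

Lemma heis_sum12 (F : 'I_n -> heis R n) : (\sum_(i < n) F i).1.2 = \sum_(i < n) (F i).1.2.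
Proof. by apply: (big_morph (fun p : heis R n => p.1.2)). Qed.

Lemma heis_sum2 (F : 'I_n -> heis R n) :
  ((\sum_(i < n) F i).2 : R) = \sum_(i < n) ((F i).2 : R).
Proof. by apply: (big_morph (fun p : heis R n => p.2 : R)). Qed.

Lemma horizontal_combE (a b : 'I_n -> R) p :
  \sum_(i < n) (a i *: hX i p + b i *: hY i p) =
  (\row_i a i, \row_i b i,
   \sum_(i < n) (b i * hx p i - a i * hy p i) / 2 : measurableTypeR R).
Proof.
apply: heis_ext.
- rewrite heis_sum11 [RHS]row_sum_delta; apply: eq_bigr => i _.
  by rewrite /= scaler0 addr0 mxE.
- rewrite heis_sum12 [RHS]row_sum_delta; apply: eq_bigr => i _.
  by rewrite /= scaler0 add0r mxE.
- rewrite heis_sum2; apply: eq_bigr => i _.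
  change (a i * - (hy p i / 2) + b i * (hx p i / 2) = (b i * hx p i - a i * hy p i) / 2).
  by ring.
Qed.

Lemma speed_le_l1 (a b : 'I_n -> R -> R) (s : R) :
  speed a b s <= \sum_(i < n) (`|a i s| + `|b i s|).
Proof.
set S := leRHS.
have S0 : 0 <= S by apply: sumr_ge0 => i _; rewrite addr_ge0.
rewrite -(ger0_norm S0) -sqrtr_sqr ler_wsqrtr// expr2 /S [leRHS]mulr_suml.
apply: ler_sum => i _.
have iS : `|a i s| + `|b i s| <= S.
  by rewrite /S (bigD1 i)//= lerDl sumr_ge0// => j _; rewrite addr_ge0.
rewrite -(real_normK (num_real (a i s))) -(real_normK (num_real (b i s))) mulrDl !expr2.
have a0 := normr_ge0 (a i s); have b0 := normr_ge0 (b i s).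
by apply: lerD; apply: ler_wpM2l => //; apply: le_trans iS; rewrite ?lerDl ?lerDr.
Qed.

(** The segment from 0 is horizontal: at the point s (x, y, 0) the t-velocity is a sum of terms s
    (y_i x_i - x_i y_i) / 2 = 0. Its length is at most the l^1 norm. *)
Lemma cc_dist_line (x y : 'rV[R]_n) :
  (cc_dist 0%R (x, y, 0%R : measurableTypeR R) <=
   (\sum_(i < n) (`|x ord0 i| + `|y ord0 i|))%:E)%E.
Proof.
pose v : heis R n := (x, y, 0 : measurableTypeR R).
pose gamma (s : R) : heis R n := s *: v.
pose a (i : 'I_n) (s : R) := x ord0 i; pose b (i : 'I_n) (s : R) := y ord0 i.
have hor : horizontal gamma a b.
  split; [|by move=> i; exact: measurable_cst|by move=> i; exact: measurable_cst|].
    apply: (@abs_continuous_comp_lipschitz _ _ _ gamma `|v| 0 1 id);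
      last exact: abs_continuous_id.
    by move=> s t /=; rewrite /gamma -scalerBl normrZ mulrC.
  apply: aeW => /= s _.
  have -> : \sum_(i < n) (a i s *: hX i (gamma s) + b i s *: hY i (gamma s)) = v.
    rewrite horizontal_combE; apply: heis_ext => /=.
    - by apply/rowP => i; rewrite mxE.
    - by apply/rowP => i; rewrite mxE.
    - rewrite big1// => i _; rewrite /gamma /hx /hy /= !mxE /a /b.
      by rewrite mulrCA [x _ _ * _]mulrC mulrA subrr mul0r.
  apply/is_derive1P => e e0; exists 1 => // z _.
  by rewrite /gamma -!scalerBl subrr scale0r normr0 mulr_ge0// ltW.
have -> : 0 = gamma 0 by rewrite /gamma scale0r.
rewrite -/v; have -> : v = gamma 1 by rewrite /gamma scale1r.
apply: le_trans (cc_dist_le_length hor) _.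
apply: (@le_trans _ _ (\int[lebesgue_measure]_(s in `[0%R, 1%R])
   (\sum_(i < n) (`|x ord0 i| + `|y ord0 i|))%:E)%E).
  apply: ge0_le_integral => //=.
  - by apply/measurable_EFinP; apply: measurable_speed => i; exact: measurable_cst.
  - by move=> s _; rewrite lee_fin; exact: speed_le_l1.
rewrite integral_cst//=.
have /= -> := @lebesgue_measure_itv R `[0, 1].
by rewrite lte_fin ltr01 sube0 mule1.
Qed.

Lemma cc_dist0_mul p q : (cc_dist 0%R (heis_mul p q) <= cc_dist 0%R p + cc_dist 0%R q)%E.
Proof.
apply: le_trans (cc_dist_triangle p _ _) _; apply: leeD => //.
by rewrite -[X in cc_dist X _]heis_mulg0 cc_dist_mul.
Qed.

Lemma cc_dist_vertical (t : R) : (0 < n)%N ->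
  (cc_dist (0%R : heis R n) (0%R, 0%R, t : measurableTypeR R) <=
    (4 * Num.sqrt `|t|)%:E)%E.
Proof.
move=> n0; pose i0 := Ordinal n0.
(* The commutator of exp(s X_i) and exp(s Y_i) is (0, 0, s^2). *)
pose P (a b t : R) : heis R n :=
  (a *: delta_mx ord0 i0, b *: delta_mx ord0 i0, t : measurableTypeR R).
have PM a b u a' b' u' : heis_mul (P a b u) (P a' b' u') =
    P (a + a') (b + b') (u + u' + 2^-1 * (a * b' - b * a')).
  apply: heis_ext; rewrite /= ?scalerDl//.
  congr (_ + _ * _); rewrite (bigD1 i0)//= big1 => [|j ji].
    by rewrite /hx /hy /= !mxE !eqxx /= !mulr1 addr0.
  by rewrite /hx /hy /= !mxE (negPf ji) /= !mulr0 subrr.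
have dP a b : (cc_dist 0%R (P a b 0%R) <= (`|a| + `|b|)%:E)%E.
  apply: le_trans (cc_dist_line _ _) _.
  rewrite lee_fin (bigD1 i0)//= big1 => [|j ji]; last first.
    by rewrite !mxE (negPf ji) /= !mulr0 normr0 addr0.
  by rewrite !mxE !eqxx /= !mulr1 addr0.
pose s := Num.sqrt `|t|; have s0 : 0 <= s by exact: sqrtr_ge0.
have ss : s * s = `|t| by rewrite -expr2 sqr_sqrtr.
have dX a : (cc_dist 0%R (P a 0%R 0%R) <= `|a|%:E)%E.
  by apply: le_trans (dP _ _) _; rewrite normr0 addr0.
have dY a : (cc_dist 0%R (P 0%R a 0%R) <= `|a|%:E)%E.
  by apply: le_trans (dP _ _) _; rewrite normr0 add0r.
have four A B C D : (cc_dist 0%R A <= s%:E -> cc_dist 0%R B <= s%:E ->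
    cc_dist 0%R C <= s%:E -> cc_dist 0%R D <= s%:E ->
    cc_dist (0%R : heis R n) (heis_mul (heis_mul (heis_mul A B) C) D) <= (4 * s)%:E)%E.
  move=> hA hB hC hD.
  have -> : (4 * s)%:E = (s%:E + s%:E + s%:E + s%:E)%E.
    by rewrite -!EFinD; congr EFin; ring.
  apply: le_trans (cc_dist0_mul _ _) _; apply: leeD => //.
  apply: le_trans (cc_dist0_mul _ _) _; apply: leeD => //.
  by apply: le_trans (cc_dist0_mul _ _) _; apply: leeD.
have sn : `|s| = s by rewrite ger0_norm.
have sn' : `|- s| = s by rewrite normrN.
have [t0|t0] := leP 0 t.
  have -> : (0, 0, t) =
      heis_mul (heis_mul (heis_mul (P s 0 0) (P 0 s 0)) (P (- s) 0 0)) (P 0 (- s) 0).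
    rewrite !PM; apply: heis_ext; rewrite /= ?(addr0, add0r, subrr, scale0r)//.
    transitivity (s * s); first by rewrite ss ger0_norm.
    by field.
  by apply: four; (apply: le_trans (dX _) _ || apply: le_trans (dY _) _);
    rewrite ?sn ?sn'.
(* For t < 0 the two generators are exchanged, which reverses the sign of the commutator. *)
have -> : (0, 0, t) =
    heis_mul (heis_mul (heis_mul (P 0 s 0) (P s 0 0)) (P 0 (- s) 0)) (P (- s) 0 0).
  rewrite !PM; apply: heis_ext; rewrite /= ?(addr0, add0r, subrr, scale0r)//.
  transitivity (- (s * s)); first by rewrite ss ltr0_norm// opprK.
  by field.
by apply: four; (apply: le_trans (dX _) _ || apply: le_trans (dY _) _);
  rewrite ?sn ?sn'.
Qed.

End local_bound.

Section balls.
Context {R : realType} {n : nat}.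
Implicit Types p q v : heis R n.

Lemma cc_dist_refl p : cc_dist p p = 0%E.
Proof.
apply/eqP; rewrite eq_le cc_dist_ge0 andbT.
have -> : cc_dist p p = cc_dist (0%R : heis R n) 0%R.
  by rewrite -[in RHS](cc_dist_mul p) heis_mulg0.
apply: le_trans (cc_dist_line 0 0) _.
by rewrite big1// => i _; rewrite !mxE normr0 addr0.
Qed.

Definition heis_l1 p : R := \sum_(i < n) (`|hx p i| + `|hy p i|).

(** Translating p to 0 turns q into (x, y, t) with (x, y) the horizontal part of q - p and t
    corrected by the symplectic term; this point is the product of (x, y, 0) and (0, 0, t), each of
    known cost. *)
Lemma cc_dist_le_coord p q : (0 < n)%N ->
  (cc_dist p q <= (heis_l1 (q - p) +
     4 * Num.sqrt `|((q - p).2 : R) - 2^-1 * symp p (q - p)|)%:E)%E.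
Proof.
move=> n0.
pose w := heis_mul (heis_inv p) q.
have -> : cc_dist p q = cc_dist 0%R w.
  rewrite -(cc_dist_mul (heis_inv p)) -/w; congr (cc_dist _ _).
  by rewrite -[X in heis_mul _ X]heis_mulg0 heis_mulKg.
pose tw : R := w.2.
have -> : w = heis_mul (w.1.1, w.1.2, 0 : measurableTypeR R)
    (0, 0, tw : measurableTypeR R).
  apply: heis_ext; [by rewrite /= addr0|by rewrite /= addr0|].
  pose z : heis R n := (w.1.1, w.1.2, 0 : measurableTypeR R).
  change (tw = 0 + tw + 2^-1 * symp z (0, 0, tw : measurableTypeR R)).
  rewrite sympE big1 ?mulr0 ?addr0 ?add0r// => i _.
  by rewrite !mxE !mulr0 subrr.
apply: le_trans (cc_dist0_mul _ _) _; rewrite EFinD; apply: leeD.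
  apply: le_trans (cc_dist_line _ _) _.
  rewrite lee_fin /heis_l1; apply: ler_sum => i _.
  by rewrite /hx /hy /= !mxE ![- _ + _]addrC.
apply: le_trans (cc_dist_vertical _ n0) _; rewrite lee_fin.
rewrite (_ : tw = ((q - p).2 : R) - 2^-1 * symp p (q - p))//.
rewrite sympBr symp_diag subr0.
have E : symp (heis_inv p) q = - symp p q.
  by rewrite !sympE -sumrN; apply: eq_bigr => i _; rewrite !mxE; ring.
change (- (p.2 : R) + (q.2 : R) + 2^-1 * symp (heis_inv p) q =
  (q.2 : R) - (p.2 : R) - 2^-1 * symp p q).
by rewrite E; ring.
Qed.

Lemma heis_boxP p q (e : R) : heis_box p e q -> `|q - p| <= e.
Proof.
move=> [qx qy qt]; have e0 : 0 <= e by apply: le_trans (ltW qt).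
apply/heis_normP => //; split => [i|i|].
- by rewrite /hx !mxE; apply/ltW; exact: qx.
- by rewrite /hy !mxE; apply/ltW; exact: qy.
- exact: ltW.
Qed.

Lemma cc_dist_locally_small p (e : R) : (0 < n)%N -> 0 < e ->
  exists2 d, 0 < d & forall q, heis_box p d q -> (cc_dist p q < e%:E)%E.
Proof.
move=> n0 e0; pose S := heis_l1 p.
have S0 : 0 <= S by apply: sumr_ge0 => i _; rewrite addr_ge0.
(* The first bound keeps the 2n horizontal terms below e / 4 in total; the second keeps the vertical
   term below (e / 16)^2, so that four times its root is again at most e / 4. *)
pose d := Num.min (e / (8 * n.+1%:R)) ((e / 16) ^+ 2 / (1 + S)).
have d0 : 0 < d.
  by rewrite lt_min !divr_gt0 ?mulr_gt0 ?exprn_gt0 ?divr_gt0 ?ltr_wpDr.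
exists d => // q /heis_boxP qp.
have [vx vy vt] := heis_norm_coord (q - p).
apply: le_lt_trans (cc_dist_le_coord p q n0) _; rewrite lte_fin.
have A : heis_l1 (q - p) <= e / 4.
  apply: (@le_trans _ _ (\sum_(i < n) (d + d))).
    apply: ler_sum => i _; apply: lerD.
      exact: le_trans (vx i) qp.
    exact: le_trans (vy i) qp.
  rewrite sumr_const card_ord -[leLHS]mulr_natl.
  have dn : d * (8 * n.+1%:R) <= e.
    by rewrite -ler_pdivlMr ?mulr_gt0// /d ge_min lexx.
  have : n%:R <= n.+1%:R :> R by rewrite ler_nat.
  move: dn; move: (n%:R) (n.+1%:R) => x y dy xy.
  have : d * x <= d * y by rewrite ler_wpM2l// ltW.
  by move: (d) dy => z ? ?; lra.
have B : `|((q - p).2 : R) - 2^-1 * symp p (q - p)| <= (e / 16) ^+ 2.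
  apply: (@le_trans _ _ ((1 + S) * d)); last first.
    by rewrite mulrC -ler_pdivlMr ?ltr_wpDr// /d ge_min lexx orbT.
  apply: le_trans (ler_normB _ _) _; rewrite mulrDl mul1r; apply: lerD.
    exact: le_trans vt qp.
  rewrite normrM ger0_norm ?invr_ge0//.
  apply: (@le_trans _ _ `|symp p (q - p)|).
    by rewrite ler_piMl// invf_le1// ler1n.
  by apply: le_trans (symp_bound _ _) _; rewrite ler_wpM2l.
have C : Num.sqrt `|((q - p).2 : R) - 2^-1 * symp p (q - p)| <= e / 16.
  apply: (@le_trans _ _ (Num.sqrt ((e / 16) ^+ 2))); first exact: ler_wsqrtr.
  by rewrite sqrtr_sqr gtr0_norm// divr_gt0.
apply: le_lt_trans (lerD A (ler_wpM2l _ C)) _ => //.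
by move: (e) e0 => z ?; lra.
Qed.

Lemma cc_ball_box_open p (r : R) q : (0 < n)%N -> cc_ball p r q ->
  exists2 d, 0 < d & heis_box q d `<=` cc_ball p r.
Proof.
rewrite /cc_ball /= => n0 pq.
have fpq : cc_dist p q \is a fin_num.
  by rewrite ge0_fin_numE ?cc_dist_ge0// (lt_trans pq) ?ltry.
have e0 : 0 < r - fine (cc_dist p q).
  by rewrite subr_gt0 -lte_fin fineK.
have [d d0 H] := cc_dist_locally_small q n0 e0; exists d => // w /H qw.
apply: le_lt_trans (cc_dist_triangle q _ _) _.
by rewrite -(fineK fpq) -lteBrDl// -EFinB.
Qed.

Lemma measurable_cc_ball p (r : R) : (0 < n)%N -> measurable (cc_ball p r).
Proof.
by move=> n0; apply: box_open_measurable => q /(cc_ball_box_open n0).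
Qed.

Lemma cc_ball_gt0 p (r : R) : (0 < n)%N -> 0 < r ->
  (0 < heis_lebesgue (cc_ball p r))%E.
Proof.
move=> n0 r0; have pp : cc_ball p r p by rewrite /cc_ball /= cc_dist_refl lte_fin.
have [d d0 sub] := cc_ball_box_open n0 pp.
apply: (@lt_le_trans _ _ (heis_lebesgue (heis_box p d))).
  by rewrite heis_lebesgue_box// lte_fin exprn_gt0// mulr_gt0.
by apply: le_measure; rewrite ?inE//; [exact: measurable_heis_box|exact: measurable_cc_ball].
Qed.

End balls.

(** * Boundedness and finite volume of the balls *)

Section bounded_balls.
Context {R : realType} {n : nat}.
Implicit Types p q v : heis R n.
Notation mu := (@lebesgue_measure R).

Lemma normr_le_speed (a b : 'I_n -> R -> R) s i :
  `|a i s| <= speed a b s /\ `|b i s| <= speed a b s.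
Proof.
have le (x : R) : x ^+ 2 <= a i s ^+ 2 + b i s ^+ 2 -> `|x| <= speed a b s.
  move=> xab; rewrite -sqrtr_sqr ler_wsqrtr//; apply: le_trans xab _.
  by rewrite (bigD1 i)//= lerDl sumr_ge0// => j _; rewrite addr_ge0 ?sqr_ge0.
by split; apply: le; rewrite ?lerDl ?lerDr ?sqr_ge0.
Qed.

(** [phi \o gamma] is a real absolutely continuous function whose derivative is phi of the velocity.
    The bound is asked only along [gamma], so C may depend on estimates already obtained there: the
    t-velocity involves x and y. *)
Lemma horizontal_functional_bound (gamma : R -> heis R n) a b (phi : heis R n -> R)
    (C s : R) :
  horizontal gamma a b -> (horizontal_length a b < +oo)%E ->
  (forall p q, phi (p - q) = phi p - phi q) -> (forall c p, phi (c *: p) = c * phi p) ->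
  (forall p, `|phi p| <= `|p|) -> 0 <= C ->
  (forall s, 0 <= s <= 1 ->
    `|phi (\sum_(i < n) (a i s *: hX i (gamma s) + b i s *: hY i (gamma s)))| <=
      C * speed a b s) ->
  0 <= s <= 1 ->
  `|phi (gamma s) - phi (gamma 0)| <= C * fine (horizontal_length a b).
Proof.
move=> [ac ma mb dg] len phiB phiZ phi1 C0 phiV s01.
have sp0 x : 0 <= speed a b x by exact: sqrtr_ge0.
have isp : mu.-integrable `[0, 1] (EFin \o speed a b).
  apply/integrableP; split; first by apply/measurable_EFinP; exact: measurable_speed.
  apply: le_lt_trans len; rewrite le_eqVlt; apply/orP; left; apply/eqP.
  by apply: eq_integral => x _; rewrite /= ger0_norm.
have iC : mu.-integrable `[0, 1] (EFin \o (fun x => C * speed a b x)).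
  rewrite (_ : _ \o _ = fun x => (C%:E * (EFin \o speed a b) x)%E) //.
  by apply: integrableZl.
have -> : C * fine (horizontal_length a b) = \int[mu]_(x in `[0, 1]) (C * speed a b x).
  by rewrite RintegralZl.
apply: (@abs_continuous_le_integral _ (phi \o gamma)) => //.
- apply: (@abs_continuous_comp_lipschitz _ _ _ phi 1 _ _ gamma) => // u v.
  by rewrite -phiB mul1r; exact: phi1.
- by move=> x; rewrite mulr_ge0.
- have ? := ae_filter_ringOfSetsType mu.
  apply: filterS dg => x H x01; have := phiV x x01 => bd.
  exists (phi (\sum_(i < n) (a i x *: hX i (gamma x) + b i x *: hY i (gamma x)))) => //.
  apply: (@is_derive_comp_affine _ _ _ phi phi 1) => //; last exact: H.
  by move=> u; rewrite mul1r; exact: phi1.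
Qed.

Lemma cc_ball_bounded p (r : R) : 0 < r ->
  exists2 M, 0 < M & cc_ball p r `<=` heis_box p M.
Proof.
move=> r0.
(* K bounds each x_i and y_i along a curve of length below r from p, so t moves at most at n K times
   the speed. *)
pose K := `|p| + r; have K0 : 0 <= K by rewrite addr_ge0// ltW.
(* The summand r serves x and y, n K r serves t, and 1 makes the inequalities strict. *)
pose M := r + n%:R * K * r + 1; exists M.
  by rewrite /M ltr_wpDl// addr_ge0 ?mulr_ge0// ltW.
move=> q; rewrite /cc_ball /= => /ereal_inf_lt[_ [gamma [a [b [hor g0 g1 ->]]]] len].
have fl : (horizontal_length a b < +oo)%E by rewrite (lt_trans len) ?ltry.
pose l := fine (horizontal_length a b).
have lr : l <= r.
  rewrite /l -lee_fin fineK ?ltW//.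
  by rewrite ge0_fin_numE//; apply: integral_ge0 => s _; rewrite lee_fin sqrtr_ge0.
have xb i s : 0 <= s <= 1 -> `|hx (gamma s) i - hx p i| <= r.
  move=> s01; rewrite -g0; apply: le_trans lr; rewrite -[l]mul1r.
  apply: (@horizontal_functional_bound _ _ _ (fun v => hx v i) 1 s hor) => //.
  - by move=> u v; rewrite /hx !mxE.
  - by move=> c v; rewrite /hx !mxE.
  - by move=> v; have [] := heis_norm_coord v.
  - move=> s' _; rewrite horizontal_combE /hx /= mxE mul1r.
    by have [] := normr_le_speed a b s' i.
have yb i s : 0 <= s <= 1 -> `|hy (gamma s) i - hy p i| <= r.
  move=> s01; rewrite -g0; apply: le_trans lr; rewrite -[l]mul1r.
  apply: (@horizontal_functional_bound _ _ _ (fun v => hy v i) 1 s hor) => //.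
  - by move=> u v; rewrite /hy !mxE.
  - by move=> c v; rewrite /hy !mxE.
  - by move=> v; have [] := heis_norm_coord v.
  - move=> s' _; rewrite horizontal_combE /hy /= mxE mul1r.
    by have [] := normr_le_speed a b s' i.
have [px py _] := heis_norm_coord p.
have one01 : 0 <= (1 : R) <= 1 by rewrite ler01 lexx.
have rM : r < M.
  by rewrite /M -addrA ltrDl ltr_wpDl// !mulr_ge0// ltW.
split => [i|i|].
- by rewrite -g1; apply: le_lt_trans rM; exact: xb.
- by rewrite -g1; apply: le_lt_trans rM; exact: yb.
- rewrite -g1 -g0; apply: (@le_lt_trans _ _ (n%:R * K * l)); last first.
    apply: (@le_lt_trans _ _ (n%:R * K * r)); first by rewrite ler_wpM2l// mulr_ge0.
    rewrite /M -[ltLHS]add0r -addrA.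
    by apply: ltr_leD => //; rewrite lerDl.
  apply: (@horizontal_functional_bound _ _ _ (fun v => v.2 : R) _ 1 hor) => //.
  + by move=> v; have [] := heis_norm_coord v.
  + by rewrite mulr_ge0.
  + move=> s s01; rewrite horizontal_combE /=.
    apply: le_trans (ler_norm_sum _ _ _) _.
    apply: (@le_trans _ _ (\sum_(i < n) (K * speed a b s))); last first.
      by rewrite sumr_const card_ord -[leLHS]mulr_natl mulrA.
    apply: ler_sum => i _.
    have [ai bi] := normr_le_speed a b s i.
    have xK : `|hx (gamma s) i| <= K.
      rewrite -(subrK (hx p i) (hx (gamma s) i)) addrC.
      by apply: le_trans (ler_normD _ _) _; apply: lerD => //; exact: xb.
    have yK : `|hy (gamma s) i| <= K.
      rewrite -(subrK (hy p i) (hy (gamma s) i)) addrC.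
      by apply: le_trans (ler_normD _ _) _; apply: lerD => //; exact: yb.
    rewrite normrM [`|2^-1|]ger0_norm ?invr_ge0// ler_pdivrMr//.
    apply: le_trans (ler_normB _ _) _; rewrite !normrM mulr_natr mulr2n.
    by apply: lerD; rewrite [leRHS]mulrC; apply: ler_pM.
Qed.

Lemma cc_ball_fin_num p (r : R) : (0 < n)%N -> 0 < r ->
  heis_lebesgue (cc_ball p r) \is a fin_num.
Proof.
move=> n0 r0; have [M M0 sub] := cc_ball_bounded p r0.
rewrite ge0_fin_numE//; apply: (@le_lt_trans _ _ (heis_lebesgue (heis_box p M))).
  by apply: le_measure; rewrite ?inE//; [exact: measurable_cc_ball|exact: measurable_heis_box].
by rewrite heis_lebesgue_box// ltry.
Qed.

End bounded_balls.

(* Spares us the measurability of [cc_dist]: for nonnegative functions, the integral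
   is a supremum over the simple functions below. *)
Lemma ge0_le_integral_nonmeasurable d (T : measurableType d) (R : realType)
    (mu : {measure set T -> \bar R}) (f g : T -> \bar R) :
  (forall x, 0 <= f x)%E -> (forall x, f x <= g x)%E ->
  (\int[mu]_x f x <= \int[mu]_x g x)%E.
Proof.
move=> f0 fg; have g0 x : (0 <= g x)%E by exact: le_trans (fg x).
rewrite !ge0_integralTE//; apply: ereal_sup_le => _ [h hf <-]; exists h => // x.
exact: le_trans (hf x) (fg x).
Qed.

(** * Couplings of uniform measures *)

Section uniform_coupling.
Context d (T : measurableType d) (R : realType).
Variable nu : {sigma_finite_measure set T -> \bar R}.
Variables A B : set T.
Hypotheses (mA : measurable A) (mB : measurable B).
Variable V : R.
Hypotheses (V0 : 0 < V) (nuA : nu A = V%:E) (nuB : nu B = V%:E).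

Let C := A `&` B.
Let D1 := A `\` B.
Let D2 := B `\` A.
Let theta := fine (nu D1).

Let mC : measurable C. Proof. exact: measurableI. Qed.
Let mD1 : measurable D1. Proof. exact: measurableD. Qed.
Let mD2 : measurable D2. Proof. exact: measurableD. Qed.
Let mD12 : measurable (D1 `*` D2). Proof. exact: measurableX. Qed.

Let finite_sub S : measurable S -> S `<=` A \/ S `<=` B -> nu S \is a fin_num.
Proof.
move=> mS SAB; rewrite ge0_fin_numE//; apply: (@le_lt_trans _ _ V%:E); last exact: ltry.
by case: SAB => sub; [rewrite -nuA|rewrite -nuB]; apply: le_measure; rewrite ?inE.
Qed.

Let nuD1 : nu D1 = theta%:E.
Proof. by rewrite fineK// finite_sub//; left; exact: subDsetl. Qed.

Let nuC : nu C = (V - theta)%:E.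
Proof.
have fC : nu C \is a fin_num by apply: finite_sub => //; left; exact: subIsetl.
have : (nu A = nu C + nu D1)%E.
  rewrite -measureU//; first by rewrite /C /D1 setUIDK.
  by rewrite /C /D1 setDE setIACA setICr setI0.
rewrite nuA nuD1 -(fineK fC) -EFinD => -[->].
by rewrite addrK.
Qed.

(** A and B have the same volume and share C, so what remains of each is equally large. *)
Let nuD2 : nu D2 = theta%:E.
Proof.
have fD : nu D2 \is a fin_num by apply: finite_sub => //; right; exact: subDsetl.
have : (nu B = nu C + nu D2)%E.
  rewrite -measureU//; first by rewrite /C /D2 [A `&` B]setIC setUIDK.
  by rewrite /C /D2 setDE [A `&` B]setIC setIACA setICr setI0.
by rewrite nuB nuC -(fineK fD) -EFinD => -[E]; congr EFin; lra.
Qed.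

Let theta0 : 0 <= theta. Proof. exact: fine_ge0. Qed.

Let prodE X Y : measurable X -> measurable Y ->
  (nu \x nu)%E (X `*` Y) = (nu X * nu Y)%E.
Proof. exact: product_measure1E. Qed.

Let diag (z : T) : T * T := (z, z).
Let mdiag : measurable_fun setT diag.
Proof. by apply/measurable_fun_pairP; split; exact: measurable_id. Qed.

Let invV0 : 0 <= V^-1. Proof. by rewrite invr_ge0 ltW. Qed.
Let invtheta0 : 0 <= theta^-1. Proof. by rewrite invr_ge0. Qed.

(* If theta = 0 then [theta^-1 = 0] and the product part vanishes, as it should. *)
Definition uniform_coupling_measure : {measure set (T * T) -> \bar R} :=
  mscale (NngNum invV0) (measure_add
    (measure_function_pushforward__canonical__measure_function_Measure
      (mrestr nu mC) mdiag)
    (mscale (NngNum invtheta0) (mrestr (nu \x nu)%E mD12))).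

(** The common part C sits on the diagonal and stays in place. The product measure gives D1 x D2 the
    mass theta^2, and dividing by theta leaves marginals of mass theta on D1 and D2. *)
Lemma uniform_coupling_measureE S : uniform_coupling_measure S =
  (V^-1%:E * (nu (diag @^-1` S `&` C) +
     theta^-1%:E * (nu \x nu) (S `&` D1 `*` D2)))%E.
Proof. exact: (congr1 (mule V^-1%:E) (measure_addE _ _ S)). Qed.

Lemma uniform_couplingT : uniform_coupling_measure setT = 1%E.
Proof.
rewrite uniform_coupling_measureE preimage_setT !setTI nuC.
rewrite prodE// nuD1 nuD2 -(EFinM theta theta) -(EFinM theta^-1) -EFinD -EFinM.
congr EFin.
have [t0|t0] := eqVneq theta 0.
  by rewrite t0 !mulr0 addr0 subr0 mulVf// gt_eqF.
by rewrite mulrA mulVf// mul1r subrK mulVf// gt_eqF.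
Qed.

Definition uniform_coupling : probability (T * T)%type R :=
  HB.pack (uniform_coupling_measure : set (T * T) -> \bar R)
    (Measure.on uniform_coupling_measure)
    (Measure_isProbability.Build _ _ _ uniform_coupling_measure uniform_couplingT).

Lemma uniform_couplingE S : uniform_coupling S =
  (V^-1%:E * (nu (diag @^-1` S `&` C) +
     theta^-1%:E * (nu \x nu) (S `&` D1 `*` D2)))%E.
Proof. exact: uniform_coupling_measureE. Qed.

(** If theta = 0 the left side vanishes by convention, and the right side because D is then null. *)
Let theta_cancel S D : measurable S -> measurable D -> nu D = theta%:E ->
  (theta^-1%:E * (nu (S `&` D) * theta%:E) = nu (S `&` D))%E.
Proof.
move=> mS mD nuD; have [t0|t0] := eqVneq theta 0.
  rewrite t0 mule0 mule0; apply/esym/eqP.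
  rewrite eq_le measure_ge0 andbT.
  have -> : (0 = nu D)%E by rewrite nuD t0.
  by apply: le_measure; rewrite ?inE//; exact: measurableI.
by rewrite muleC -muleA -EFinM mulfV// mule1.
Qed.

Lemma uniform_coupling_fst S : measurable S ->
  uniform_coupling (S `*` setT) = (V^-1%:E * nu (S `&` A))%E.
Proof.
move=> mS; rewrite uniform_couplingE.
rewrite -setXI setTI prodE//; last exact: measurableI.
rewrite nuD2 theta_cancel// -measureU//.
- congr (_ * nu _)%E; apply/seteqP; split => z; rewrite /C /D1 /diag /=.
    by move=> [[[? _] [? _]]|[? [? _]]]; split.
  by move=> [Sz Az]; have [Bz|nBz] := pselect (B z); [left|right]; do !split.
- rewrite (_ : diag @^-1` _ = S); first exact: measurableI.
  by apply/seteqP; split => z; rewrite /diag /= => // -[].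
- exact: measurableI.
- by rewrite -subset0 => z [[_ [_ Bz]] [_ [_]]].
Qed.

Lemma uniform_coupling_snd S : measurable S ->
  uniform_coupling (setT `*` S) = (V^-1%:E * nu (S `&` B))%E.
Proof.
move=> mS; rewrite uniform_couplingE.
rewrite -setXI setTI prodE//; last exact: measurableI.
rewrite nuD1 [(theta%:E * _)%E]muleC theta_cancel// -measureU//.
- congr (_ * nu _)%E; apply/seteqP; split => z; rewrite /C /D2 /diag /=.
    by move=> [[[_ ?] [_ ?]]|[? [? _]]]; split.
  by move=> [Sz Bz]; have [Az|nAz] := pselect (A z); [left|right]; do !split.
- rewrite (_ : diag @^-1` _ = S); first exact: measurableI.
  by apply/seteqP; split => z; rewrite /diag /= => // -[].
- exact: measurableI.
- by rewrite -subset0 => z [[_ [Az _]] [_ [_]]].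
Qed.

(** The mass on the diagonal costs nothing, and mass theta / V is carried by D1 x D2, where each
    unit costs at most M. *)
Lemma uniform_coupling_cost (dist : T -> T -> \bar R) (M : R) :
  0 <= M -> measurable [set z : T * T | z.1 = z.2] ->
  (forall x y, 0 <= dist x y)%E -> (forall x, dist x x = 0%E) ->
  (forall x y, A x -> B y -> (dist x y <= M%:E)%E) ->
  (\int[uniform_coupling]_z dist z.1 z.2 <= (M * (theta / V))%:E)%E.
Proof.
move=> M0 mdg dist0 distxx distM.
(* Nothing is known of [dist] on E, so the majorant is +oo there; E has mass zero and +oo * 0 =
   0. *)
pose E := ~` ([set z : T * T | z.1 = z.2] `|` D1 `*` D2).
have mE : measurable E by apply: measurableC; exact: measurableU.
pose h z : \bar R := (M%:E * (\1_(D1 `*` D2) z)%:E + +oo * (\1_E z)%:E)%E.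
have h1 z : (0 <= M%:E * (\1_(D1 `*` D2) z)%:E)%E.
  by rewrite mule_ge0// lee_fin.
have h2 z : (0 <= +oo * (\1_E z)%:E :> \bar R)%E.
  by rewrite mule_ge0// lee_fin.
apply: (@le_trans _ _ (\int[uniform_coupling]_z h z)%E).
  apply: ge0_le_integral_nonmeasurable => // z; rewrite /h.
  have [zE|nzE] := pselect (E z).
    by rewrite [\1_E z]indicE mem_set// mule1 addey ?leey// gt_eqF// (lt_le_trans _ (h1 z)).
  have [zz|z12] : z.1 = z.2 \/ (D1 `*` D2) z.
    by apply: contrapT => H; apply: nzE => -[] ?; apply: H; [left|right].
    by rewrite zz distxx adde_ge0.
  rewrite [\1_(D1 `*` D2) z]indicE mem_set// mule1; apply: le_trans (leeDl _ (h2 z)).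
  by case: z12 => -[? _] [? _]; exact: distM.
rewrite /h ge0_integralD//; last 2 first.
- by apply: measurable_funeM; apply/measurable_EFinP; exact: measurable_indic.
- by apply: measurable_funeM; apply/measurable_EFinP; exact: measurable_indic.
have mind S : measurable S -> measurable_fun setT (EFin \o \1_S : T * T -> \bar R).
  by move=> mS; apply/measurable_EFinP; exact: measurable_indic.
have ind0 S (z : T * T) : [set: T * T] z -> (0 <= (\1_S z)%:E :> \bar R)%E.
  by move=> _; rewrite lee_fin.
rewrite !ge0_integralZl//; [|exact: mind..].
have xD : uniform_coupling (D1 `*` D2) = (theta / V)%:E.
  rewrite uniform_couplingE (_ : diag @^-1` (D1 `*` D2) `&` C = set0); last first.
    by rewrite -subset0 => z [[[_ nB] _] [_ /nB]].
  rewrite measure0 add0e setIid prodE// nuD1 nuD2.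
  rewrite -(EFinM theta theta) -(EFinM theta^-1) -EFinM; congr EFin.
  have [->|t0] := eqVneq theta 0; first by rewrite !mulr0 mul0r.
  by rewrite mulKf// mulrC.
have xE : uniform_coupling E = 0%E.
  rewrite uniform_couplingE (_ : diag @^-1` E `&` C = set0); last first.
    by rewrite -subset0 => z [Ez _]; apply: Ez; left.
  rewrite (_ : E `&` D1 `*` D2 = set0); last first.
    by rewrite -subset0 => z [Ez Dz]; apply: Ez; right.
  by rewrite !measure0 mule0 adde0 mule0.
rewrite !integral_indic// !setIT [X in (M%:E * X)%E]xD [X in (+oo * X)%E]xE.
by rewrite mule0 adde0 -EFinM.
Qed.

Lemma wasserstein1_uniform (dist : T -> T -> \bar R) (M : R) (muA muB : set T -> \bar R) :
  0 <= M -> measurable [set z : T * T | z.1 = z.2] ->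
  (forall x y, 0 <= dist x y)%E -> (forall x, dist x x = 0%E) ->
  (forall x y, A x -> B y -> (dist x y <= M%:E)%E) ->
  (forall S, measurable S -> muA S = V^-1%:E * nu (S `&` A))%E ->
  (forall S, measurable S -> muB S = V^-1%:E * nu (S `&` B))%E ->
  (wasserstein1 dist muA muB <= (M * (fine (nu (A `\` B)) / V))%:E)%E.
Proof.
move=> M0 mdg dist0 distxx distM hA hB.
apply: le_trans (uniform_coupling_cost M0 mdg dist0 distxx distM).
apply: ereal_inf_lbound; exists uniform_coupling => // S mS.
by rewrite uniform_coupling_fst// uniform_coupling_snd// hA// hB.
Qed.

End uniform_coupling.

(** * The curvature bound *)

Section coarse_ricci_bound.
Context {R : realType} {n : nat}.
Implicit Types x y : heis R n.

(** The diagonal is a finite intersection of sets on which one coordinate agrees, each the zero set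
    of a measurable difference. *)
Lemma measurable_heis_diag : measurable [set z : heis R n * heis R n | z.1 = z.2].
Proof.
have mz (f : heis R n -> measurableTypeR R) : measurable_fun setT f ->
    measurable [set z : heis R n * heis R n | f z.1 = f z.2].
  move=> mf.
  have mg : measurable_fun setT (fun z : heis R n * heis R n => (f z.1 : R) - f z.2).
    by apply: measurable_funB; [exact: (measurableT_comp mf measurable_fst)|
      exact: (measurableT_comp mf measurable_snd)].
  have := mg measurableT _ (measurable_set1 0); rewrite setTI; congr measurable.
  apply/seteqP; split => z /=; last by move=> ->; rewrite subrr.
  by move=> /eqP; rewrite subr_eq0 => /eqP.
rewrite (_ : [set _ | _] = \bigcap_(i in [set: 'I_n]) [set z | hx z.1 i = hx z.2 i] `&`
    \bigcap_(i in [set: 'I_n]) [set z | hy z.1 i = hy z.2 i] `&`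
    [set z | (z.1.2 : measurableTypeR R) = z.2.2]); last first.
  apply/seteqP; split => [[p q] /= -> //|[p q] [[/= H1 H2] H3]].
  apply: heis_ext => //; apply/rowP => i; [exact: H1|exact: H2].
apply: measurableI; [apply: measurableI|].
- apply: fin_bigcap_measurable => // i _; apply: (mz (fun p => hx p i)).
  apply: (measurableT_comp (measurable_coord i)).
  exact: (measurableT_comp measurable_fst measurable_fst).
- apply: fin_bigcap_measurable => // i _; apply: (mz (fun p => hy p i)).
  apply: (measurableT_comp (measurable_coord i)).
  exact: (measurableT_comp measurable_snd measurable_fst).
- by apply: (mz (fun p => p.2)); exact: measurable_snd.
Qed.

Lemma heis_lebesgue_cc_ball x (r : R) : (0 < n)%N ->
  heis_lebesgue (cc_ball x r) = heis_lebesgue (cc_ball (0 : heis R n) r).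
Proof.
move=> n0; rewrite -{1}(heis_mulg0 x) -(heis_lebesgue_mul x (measurable_cc_ball _ _ n0)).
by rewrite cc_ball_mul.
Qed.

Lemma heis_lebesgue_cc_ball_scale x (r s : R) : (0 < n)%N -> 0 < r -> 0 < s ->
  heis_lebesgue (cc_ball x s) =
  (((s / r) ^+ (n + n + 2))%:E * heis_lebesgue (cc_ball x r))%E.
Proof.
move=> n0 r0 s0; rewrite !(heis_lebesgue_cc_ball x)//.
(* Dilation by r / s pulls the ball of radius r at 0 back to the ball of radius s. *)
have rs0 : 0 < r / s by rewrite divr_gt0.
have := heis_lebesgue_dil rs0 (measurable_cc_ball (0 : heis R n) (r / s * s) n0).
by rewrite (cc_ball_dil s rs0) -exprVn invf_div divfK ?gt_eqF.
Qed.

Lemma walkE (r V : R) x (S : set (heis R n)) : (0 < n)%N -> 0 < V ->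
  heis_lebesgue (cc_ball x r) = V%:E -> measurable S ->
  walk r x S = (V^-1%:E * heis_lebesgue (S `&` cc_ball x r))%E.
Proof.
move=> n0 V0 nuV mS; have mB := measurable_cc_ball x r n0.
rewrite /walk nuV inver gt_eqF// ge0_integralZr//.
- by rewrite integral_indic// setIC muleC.
- by apply/measurable_EFinP; apply: measurable_funTS; exact: measurable_indic.
- by rewrite lee_fin invr_ge0 ltW.
Qed.

Lemma bernoulli_onem (t : R) m : 0 <= t <= 1 -> 1 - (1 - t) ^+ m <= m%:R * t.
Proof.
move=> /andP[t0 t1]; elim: m => [|m IH]; first by rewrite expr0 subrr mul0r.
have e1 : (1 - t) ^+ m <= 1 by rewrite exprn_ile1 ?subr_ge0// gerBl.
have : (1 - t) ^+ m * t <= t by rewrite ler_piMl.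
rewrite exprSr -natr1 mulrDl mul1r; move: IH; move: (_ ^+ m) (m%:R) => e k; lra.
Qed.

Lemma wasserstein1_walk_le (r : R) x y : (0 < n)%N -> 0 < r ->
  cc_dist x y \is a fin_num ->
  (wasserstein1 cc_dist (walk r x) (walk r y) <=
   (2 * (2 * n%:R + 3))%:E * cc_dist x y)%E.
Proof.
move=> n0 r0 fxy; set d := fine (cc_dist x y).
have dE : cc_dist x y = d%:E by rewrite fineK.
have d0 : 0 <= d by rewrite fine_ge0// cc_dist_ge0.
pose V := fine (heis_lebesgue (cc_ball x r)).
have nuA : heis_lebesgue (cc_ball x r) = V%:E by rewrite fineK// cc_ball_fin_num.
have nuB : heis_lebesgue (cc_ball y r) = V%:E.
  exact: etrans (heis_lebesgue_cc_ball y r n0)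
    (etrans (esym (heis_lebesgue_cc_ball x r n0)) nuA).
have V0 : 0 < V by rewrite -lte_fin -nuA cc_ball_gt0.
have mA := measurable_cc_ball x r n0; have mB := measurable_cc_ball y r n0.
have M0 : 0 <= 2 * r + d by rewrite addr_ge0// mulr_ge0// ltW.
have distM z w : cc_ball x r z -> cc_ball y r w ->
    (cc_dist z w <= (2 * r + d)%:E)%E.
  rewrite /cc_ball /= => xz yw; apply: le_trans (cc_dist_triangle x _ _) _.
  have -> : (2 * r + d)%:E = (r%:E + (d%:E + r%:E))%E.
    by rewrite -!EFinD; congr EFin; ring.
  apply: leeD; first by rewrite cc_dist_sym ltW.
  apply: le_trans (cc_dist_triangle y _ _) _; apply: leeD; last exact: ltW.
  by rewrite dE.
pose theta := fine (heis_lebesgue (cc_ball x r `\` cc_ball y r)).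
have W : (wasserstein1 cc_dist (walk r x) (walk r y) <=
    ((2 * r + d) * (theta / V))%:E)%E.
  have hx S (mS : measurable S) := walkE n0 V0 nuA mS.
  have hy S (mS : measurable S) := walkE n0 V0 nuB mS.
  exact: (wasserstein1_uniform (nu := heis_lebesgue) mA mB V0 nuA nuB M0
    measurable_heis_diag (@cc_dist_ge0 R n) (@cc_dist_refl R n) distM hx hy).
apply: le_trans W _; rewrite dE -EFinM lee_fin.
have mD : measurable (cc_ball x r `\` cc_ball y r) by exact: measurableD.
have leV : (heis_lebesgue (cc_ball x r `\` cc_ball y r) <= V%:E)%E.
  by rewrite -nuA; apply: le_measure; rewrite ?inE//; exact: subDsetl.
have nuD : heis_lebesgue (cc_ball x r `\` cc_ball y r) = theta%:E.
  by rewrite fineK// ge0_fin_numE// (le_lt_trans leV) ?ltry.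
have thV1 : theta / V <= 1 by rewrite ler_pdivrMr// mul1r -lee_fin -nuD.
pose Q : R := (n + n + 2)%:R.
have QE : Q = 2 * n%:R + 2 by rewrite /Q !natrD; ring.
have Q1 : 2 <= Q by rewrite QE lerDr mulr_ge0.
have -> : 2 * (2 * n%:R + 3) = 2 * (Q + 1) by rewrite QE; ring.
have [far|near] := leP (2 * r) ((2 * Q + 1) * d).
  apply: le_trans (ler_wpM2l M0 thV1) _; rewrite mulr1.
  by move: (Q) far => q ?; lra.
(* Otherwise 2r <= (2Q + 1) r <= (2Q + 1) d, contrary to [near]; so r - d is a positive radius. *)
have dr : d < r.
  rewrite ltNge; apply/negP => rd; move: near; rewrite ltNge => /negP; apply.
  apply: (@le_trans _ _ ((2 * Q + 1) * r)); first by apply: ler_wpM2r; [exact: ltW|lra].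
  by apply: ler_wpM2l => //; lra.
have rd0 : 0 < r - d by rewrite subr_gt0.
have sub : cc_ball x (r - d) `<=` cc_ball x r `&` cc_ball y r.
  move=> z; rewrite /cc_ball /= => xz; split.
    by apply: lt_le_trans xz _; rewrite lee_fin gerBl.
  apply: le_lt_trans (cc_dist_triangle x _ _) _.
  by rewrite cc_dist_sym dE -lteBrDl// -EFinB.
have thQ : theta / V <= Q * (d / r).
  have mI : measurable (cc_ball x r `&` cc_ball y r) by exact: measurableI.
  have split : (V%:E = heis_lebesgue (cc_ball x r `&` cc_ball y r) + theta%:E)%E.
    rewrite -nuA -nuD -measureU//; first by rewrite setUIDK.
    by rewrite setDE setIACA setICr setI0.
  (* By dilation the ball of radius r - d has exactly this volume, and it lies in both balls. *)
  have small : (((1 - d / r) ^+ (n + n + 2) * V)%:E <=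
      heis_lebesgue (cc_ball x r `&` cc_ball y r))%E.
    rewrite EFinM -nuA (_ : 1 - d / r = (r - d) / r); last first.
      by rewrite mulrBl divff// gt_eqF.
    rewrite -heis_lebesgue_cc_ball_scale//.
    by apply: le_measure; rewrite ?inE//; exact: measurable_cc_ball.
  have : (1 - d / r) ^+ (n + n + 2) * V + theta <= V.
    by rewrite -lee_fin EFinD [leRHS]split leeD2r.
  have t01 : 0 <= d / r <= 1.
    apply/andP; split; first by apply: divr_ge0 => //; exact: ltW.
    by rewrite ler_pdivrMr// mul1r ltW.
  have := bernoulli_onem (n + n + 2) t01; rewrite -/Q => bern.
  rewrite ler_pdivrMr// => le1; apply: le_trans (ler_wpM2r (ltW V0) bern).
  by rewrite mulrBl mul1r lerBrDl.
apply: le_trans (ler_wpM2l M0 thQ) _.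
rewrite [(2 * r + d) * _]mulrA mulrA ler_pdivrMr//.
have : Q * d <= 2 * r.
  by apply: le_trans (ltW near); apply: ler_wpM2r => //; lra.
move=> Qd.
have -> : (2 * r + d) * Q * d = (2 * r * Q + Q * d) * d by ring.
have -> : 2 * (Q + 1) * d * r = (2 * r * Q + 2 * r) * d by ring.
by apply: ler_wpM2r => //; rewrite lerD2l.
Qed.

End coarse_ricci_bound.

Theorem corollary1p6 (R : realType) (n : nat) (hn : (1 <= n)%N)
    (r : R) (hr : 0 < r) :
  ((1 - 2 * (2 * n%:R + 3))%:E <=
   ereal_inf [set kappa | exists x y : heis R n,
     x <> y /\ kappa = coarse_ricci r x y])%E.
Proof.
apply: le_ereal_inf_tmp => _ [x [y [_ ->]]].
rewrite /coarse_ricci EFinB; apply: leeB => //.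
set W := wasserstein1 _ _ _; set c : R := 2 * (2 * n%:R + 3).
have c0 : 0 <= c by rewrite mulr_ge0// addr_ge0// mulr_ge0.
have W0 : (0 <= W)%E.
  apply: le_ereal_inf_tmp => _ [xi _ <-].
  by apply: integral_ge0 => z _; exact: cc_dist_ge0.
(* At infinite distance the quotient is W * 0 = 0. *)
have [fxy|] := boolP (cc_dist x y \is a fin_num); last first.
  rewrite ge0_fin_numE ?cc_dist_ge0// -leNgt leye_eq => /eqP ->.
  by rewrite invey mule0 lee_fin.
have := wasserstein1_walk_le hn hr fxy; rewrite -/W -/c.
have := cc_dist_ge0 x y; rewrite -(fineK fxy); move: (fine _) => d.
(* If d = 0, the estimate forces W = 0, and the quotient is 0 whatever value the inverse of 0
   has. *)
rewrite lee_fin le_eqVlt => /predU1P[<-|d0] Wd.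
  have -> : W = 0%E by apply/eqP; rewrite eq_le W0 andbT; rewrite mule0 in Wd.
  by rewrite mul0e lee_fin.
by rewrite inver gt_eqF// lee_pdivrMr.
Qed.
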